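(* Let $(\mathbb{T}^n,G)$ be a flow such that $G$ is abelian and all $G$-invariant functions $f\in C(\mathbb{T}^n)$ are constant. Then every equicontinuous factor of $(\mathbb{T}^n,G)$ is isomorphic to a minimal action of $G$ on some torus $\mathbb{T}^m$, $0\le m\le n$, via rotations.
   Context: A flow $(K,G)$ is a continuous action $G\times K\to K$ of a topological group $G$ on a compact Hausdorff space $K$. $C(K)$ is the space of continuous complex-valued functions on $K$; $f\in C(K)$ is $G$-invariant if $f(gx)=f(x)$ for all $g\in G$, $x\in K$. A factor of $(K,G)$ is a flow $(L,G)$ for which there is a continuous, surjective, $G$-equivariant map $K\to L$. A flow $(L,G)$ is equicontinuous if the family of maps $\{x\mapsto gx\mid g\in G\}\subset C(L,L)$ is (uniformly) equicontinuous, and minimal if every orbit is dense. Two flows of $G$ are isomorphic if there is a $G$-equivariant homeomorphism between them. $\mathbb{T}$ is the circle group; an action of $G$ on $\mathbb{T}^m$ is via rotations if each $g\in G$ acts as $x\mapsto a_g+x$ for some $a_g\in\mathbb{T}^m$. *)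

(* Defs.v *)
From HB Require Import structures.
From mathcomp Require Import all_boot all_order all_algebra.
From mathcomp Require Import complex.
From mathcomp Require Import all_classical all_reals all_analysis.

Set Implicit Arguments.
Unset Strict Implicit.
Unset Printing Implicit Defensive.

Import Order.TTheory GRing.Theory Num.Theory.
Import numFieldNormedType.Exports.

Local Open Scope classical_set_scope.
Local Open Scope complex_scope.
Local Open Scope ring_scope.

(* The library infers the norm topology for F^o and for abstract numeric fields,
   but not for the concrete field R[i]. *)
HB.instance Definition _ (R : realType) := NormedModule.copy R[i] (R[i])^o.

(* The circle group: complex numbers of modulus 1 with the subspace topology.
   The group law is complex multiplication, written additively. *)
Record circle (R : realType) := Circle {
  circle_val :> R[i];
  _ : `|circle_val| == 1
}.

HB.instance Definition _ (R : realType) := [isSub for @circle_val R].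
HB.instance Definition _ (R : realType) := [Choice of circle R by <:].
HB.instance Definition _ (R : realType) :=
  Uniform.copy (circle R) (initial_topology (@circle_val R)).

Section CircleGroup.
Variable R : realType.
Implicit Types z w : circle R.

Fact circle_zero_subproof : `|1 : R[i]| == 1.
Proof. by rewrite normr1. Qed.

Fact circle_opp_subproof z : `|(val z)^-1| == 1.
Proof. by rewrite normfV (eqP (valP z)) invr1. Qed.

Fact circle_add_subproof z w : `|val z * val w| == 1.
Proof. by rewrite normrM (eqP (valP z)) (eqP (valP w)) mulr1. Qed.

Definition circle_zero : circle R := Circle circle_zero_subproof.
Definition circle_opp z : circle R := Circle (circle_opp_subproof z).
Definition circle_add z w : circle R := Circle (circle_add_subproof z w).

Fact circle_addA : associative circle_add.
Proof. by move=> u v w; apply: val_inj; rewrite /= mulrA. Qed.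

Fact circle_addC : commutative circle_add.
Proof. by move=> u v; apply: val_inj; rewrite /= mulrC. Qed.

Fact circle_add0 : left_id circle_zero circle_add.
Proof. by move=> u; apply: val_inj; rewrite /= mul1r. Qed.

Fact circle_addN : left_inverse circle_zero circle_opp circle_add.
Proof.
move=> u; apply: val_inj; rewrite /= mulVf //.
by rewrite -normr_gt0 (eqP (valP u)) ltr01.
Qed.

HB.instance Definition _ := GRing.isZmodule.Build (circle R)
  circle_addA circle_addC circle_add0 circle_addN.
HB.instance Definition _ := isPointed.Build (circle R) 0.

End CircleGroup.

Notation torus R n := 'rV[circle R]_n.

(* A flow of an abelian topological group G, written additively, on the compact
   Hausdorff space K. *)
Record flow (G : topologicalZmodType) (K : topologicalType) := Flow {
  act :> G -> K -> K;
  flow_compact : compact [set: K];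
  flow_hausdorff : hausdorff_space K;
  act0 : forall x, act 0 x = x;
  actD : forall g h x, act (g + h) x = act g (act h x);
  act_continuous : continuous (fun p : G * K => act p.1 p.2)
}.

Section FlowNotions.
Variable G : topologicalZmodType.

Definition invariant_function (K : topologicalType) (X : flow G K) (T : Type)
  (f : K -> T) : Prop := forall g x, f (X g x) = f x.

Definition equivariant (K L : topologicalType) (X : flow G K) (Y : flow G L)
  (p : K -> L) : Prop := forall g x, p (X g x) = Y g (p x).

(* Y is a factor of X. *)
Definition flow_factor (K L : topologicalType) (X : flow G K) (Y : flow G L) : Prop :=
  exists p : K -> L,
    [/\ continuous p, set_surj setT setT p & equivariant X Y p].

Definition flow_isomorphic (K L : topologicalType) (X : flow G K) (Y : flow G L) :
    Prop :=
  exists (h : K -> L) (k : L -> K),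
    [/\ continuous h, continuous k, cancel h k, cancel k h & equivariant X Y h].

Definition flow_minimal (K : topologicalType) (X : flow G K) : Prop :=
  forall x : K, dense (range (X ^~ x)).

(* Uniform equicontinuity; the library's [equicontinuous] is its pointwise
   version. A compact Hausdorff topology is induced by exactly one uniformity,
   so taking L in uniformType does not restrict the underlying flow. *)
Definition equicontinuous_flow (L : uniformType) (Y : flow G L) : Prop :=
  forall E : set (L * L), entourage E ->
    exists2 D : set (L * L), entourage D &
      forall g x y, D (x, y) -> E (Y g x, Y g y).

Definition by_rotations (R : realType) (m : nat) (Z : flow G (torus R m)) :
    Prop :=
  forall g, exists a : torus R m, forall x, Z g x = a + x.

End FlowNotions.

(* Main.v *)
Require Import Defs.
From HB Require Import structures.
From mathcomp Require Import all_boot all_order all_algebra.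
From mathcomp Require Import complex.
From mathcomp Require Import all_classical all_reals all_analysis.
From mathcomp Require Import ring lra zify.

(** Let p be the factor map from the n-torus onto L. Continuous invariant
    functions on L pull back to invariant functions on the torus, so they are
    constant; since L is equicontinuous, suprema over orbits of continuous
    functions are continuous, and it follows that L is minimal
    ([minimal_of_invariant_const]).

    A minimal equicontinuous flow of an abelian group is a compact abelian
    group on which G acts by translations through a dense subgroup. Its
    characters are, up to constants, the eigenmaps: the continuous maps e from
    L to the circle such that e (g x) - e x depends on g only. The proof works
    with eigenmaps directly and rests on three facts.

    Eigenmaps separate the points of L ([eigenmap_separates]). This is the
    argument of Peter and Weyl. The Haar integral is replaced by the invariant
    mean, which is a limit of finite averages over G, and the convolution
    operator by the operator f |-> mean_y (d x y * f y) of an invariant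
    pseudometric d. It is self-adjoint and compact and commutes with G. Its
    restriction to the orthogonal complement of the eigenmaps would, if not
    zero, have a finite dimensional eigenspace there, and in this eigenspace
    the translations, which commute, would have a common eigenvector: after
    normalization, an eigenmap orthogonal to itself.

    An eigenmap is determined up to a constant by the degree in Z^n of its
    pullback e o p. If the degree is 0, then e o p = const + exp (i h) in
    additive notation, for a continuous real function h on the torus
    ([degree0_log]). For each g the increment h (g x) - h x does not depend on
    x; a maximum and a minimum of h show that it is 0
    ([eigen_degree0_invariant]). So h is invariant, hence constant. The degrees
    of eigenmaps form a subgroup of Z^n, which is free of some rank m <= n
    ([int_lattice_basis]). Let e_1, ..., e_m be eigenmaps whose degrees form a
    basis.

    The map F = (e_1, ..., e_m) from L to the m-torus is injective by the two
    facts above. It is surjective because the e_i are independent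
    ([independent_eigenmaps_surj]): the mean of a trigonometric polynomial in
    the e_i is its constant term, and this contradicts the exponential decay
    of the means of the powers of a Fejer-type kernel centred at a point that
    is not in the image. So F is a homeomorphism, and it carries the action on
    L to an action by rotations ([torus_model]). *)

Set Implicit Arguments.
Unset Strict Implicit.
Unset Printing Implicit Defensive.

Import Order.TTheory GRing.Theory Num.Theory.
Import numFieldNormedType.Exports.

Local Open Scope classical_set_scope.
Local Open Scope complex_scope.
Local Open Scope ring_scope.

(** * The circle in real coordinates *)
Section Circle.
Variable R : realType.
Implicit Types z w : circle R.

Definition cosz z : R := complex.Re (val z).
Definition sinz z : R := complex.Im (val z).

Lemma coszE2 z : cosz z ^+ 2 + sinz z ^+ 2 = 1.
Proof.
have := add_Re2_Im2 (val z); rewrite (eqP (valP z)) expr1n => /(congr1 (@complex.Re R)).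
by rewrite /cosz /sinz.
Qed.

Lemma circle_eqP z w : cosz z = cosz w -> sinz z = sinz w -> z = w.
Proof.
case: z w => [[a b] ?] [[c d] ?]; rewrite /cosz /sinz /= => ac bd.
by apply: val_inj; rewrite /= ac bd.
Qed.

Lemma coszD z w : cosz (z + w) = cosz z * cosz w - sinz z * sinz w.
Proof. by rewrite /cosz /sinz /=; case: z w => [[a b] ?] [[c d] ?]. Qed.

Lemma sinzD z w : sinz (z + w) = cosz z * sinz w + sinz z * cosz w.
Proof. by rewrite /cosz /sinz /=; case: z w => [[a b] ?] [[c d] ?]. Qed.

Lemma cosz0 : cosz 0 = 1. Proof. by []. Qed.
Lemma sinz0 : sinz 0 = 0. Proof. by []. Qed.

Lemma sqnorm_eq1 (a b : R) : a ^+ 2 + b ^+ 2 = 1 -> `|a +i* b| == 1.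
Proof. by move=> h; rewrite normc_def /= h sqrtr1. Qed.

Definition mk_circle (a b : R) (h : a ^+ 2 + b ^+ 2 = 1) : circle R :=
  Circle (sqnorm_eq1 h).

Lemma coszN z : cosz (- z) = cosz z.
Proof.
have := coszE2 z; rewrite /cosz /sinz /=; case: z => [[a b] ?] /= h.
by rewrite h divr1.
Qed.

Lemma sinzN z : sinz (- z) = - sinz z.
Proof.
have := coszE2 z; rewrite /cosz /sinz /=; case: z => [[a b] ?] /= h.
by rewrite h divr1.
Qed.

Lemma normc_le (x : R[i]) : `|x| <= (`|complex.Re x| + `|complex.Im x|)%:C.
Proof.
rewrite normc_def lecR -[leRHS]ger0_norm ?addr_ge0//.
rewrite -sqrtr_sqr ler_sqrt ?sqr_ge0//.
rewrite sqrrD !real_normK ?num_real//.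
by rewrite addrAC lerDl mulrn_wge0// mulr_ge0.
Qed.

Lemma Re_continuous : continuous (@complex.Re R : R[i] -> R).
Proof.
move=> x; apply/(@cvgrPdist_lt _ _ _ _ (nbhs_filter x)) => e e0.
apply/(@nbhs_normP _ R[i]); exists e%:C; first by rewrite /= ltcR.
move=> y /=; rewrite normc_def ltcR => /le_lt_trans; apply.
rewrite -sqrtr_sqr ler_sqrt ?addr_ge0 ?sqr_ge0//.
have -> : complex.Re x - complex.Re y = complex.Re (x - y) by case: (x) (y) => [? ?] [? ?].
by rewrite lerDl sqr_ge0.
Qed.

Lemma Im_continuous : continuous (@complex.Im R : R[i] -> R).
Proof.
move=> x; apply/(@cvgrPdist_lt _ _ _ _ (nbhs_filter x)) => e e0.
apply/(@nbhs_normP _ R[i]); exists e%:C; first by rewrite /= ltcR.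
move=> y /=; rewrite normc_def ltcR => /le_lt_trans; apply.
rewrite -sqrtr_sqr ler_sqrt ?addr_ge0 ?sqr_ge0//.
have -> : complex.Im x - complex.Im y = complex.Im (x - y) by case: (x) (y) => [? ?] [? ?].
by rewrite lerDr sqr_ge0.
Qed.

Lemma continuous_complex (T : topologicalType) (f : T -> R[i]) :
  continuous (fun x => complex.Re (f x)) -> continuous (fun x => complex.Im (f x)) ->
  continuous f.
Proof.
move=> cr ci x.
apply/(@cvgrPdist_lt _ R[i] T _ (nbhs_filter x)) => e e0.
have [e' -> {e0}] : exists2 e' : R, e = e'%:C & 0 < e'.
  by move: e0; case: e => [a b]; rewrite ltcE /= => /andP[/eqP -> ?]; exists a.
move=> e0; have e2 : 0 < e' / 2 by rewrite divr_gt0.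
near=> y; apply: le_lt_trans (normc_le _) _.
have -> : complex.Re (f x - f y) = complex.Re (f x) - complex.Re (f y) by case: (f x) (f y) => [? ?] [? ?].
have -> : complex.Im (f x - f y) = complex.Im (f x) - complex.Im (f y) by case: (f x) (f y) => [? ?] [? ?].
rewrite ltcR [ltRHS]splitr ltrD//.
- by near: y; apply: (@cvgr_dist_lt _ R _ _ _ _ _ (cr x)).
- by near: y; apply: (@cvgr_dist_lt _ R _ _ _ _ _ (ci x)).
Unshelve. all: by end_near. Qed.

Lemma circle_val_continuous : continuous (val : circle R -> R[i]).
Proof. exact: (@initial_continuous _ _ (@circle_val R)). Qed.

Lemma cosz_continuous : continuous cosz.
Proof.
move=> z; apply: (@continuous_comp _ _ _ (val : circle R -> R[i]) (@complex.Re R)).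
  exact: circle_val_continuous.
exact: Re_continuous.
Qed.

Lemma sinz_continuous : continuous sinz.
Proof.
move=> z; apply: (@continuous_comp _ _ _ (val : circle R -> R[i]) (@complex.Im R)).
  exact: circle_val_continuous.
exact: Im_continuous.
Qed.

(** The topology of the circle is induced from the complex plane, so continuity
    is tested on the two real coordinates. *)
Lemma continuous_circle (T : topologicalType) (f : T -> circle R) :
  continuous (fun x => cosz (f x)) -> continuous (fun x => sinz (f x)) ->
  continuous f.
Proof.
move=> cr ci; have cv : continuous (fun x => val (f x) : R[i]).
  exact: continuous_complex.
apply: (@continuous_comp_initial _ _ _ (@circle_val R) f).
exact: cv.
Qed.

Lemma continuous_circleD (T : topologicalType) (f g : T -> circle R) :
  continuous f -> continuous g -> continuous (fun x => f x + g x).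
Proof.
move=> cf cg; apply: continuous_circle => x.
- under eq_fun do rewrite coszD.
  apply: (@continuousB R R T); apply: (@continuousM R T);
    by apply: continuous_comp; [exact: cf || exact: cg |
       exact: cosz_continuous || exact: sinz_continuous].
- under eq_fun do rewrite sinzD.
  apply: (@continuousD R R T); apply: (@continuousM R T);
    by apply: continuous_comp; [exact: cf || exact: cg |
       exact: cosz_continuous || exact: sinz_continuous].
Qed.

Lemma continuous_circleN (T : topologicalType) (f : T -> circle R) :
  continuous f -> continuous (fun x => - f x).
Proof.
move=> cf; apply: continuous_circle => x.
- under eq_fun do rewrite coszN.
  by apply: continuous_comp; [exact: cf|exact: cosz_continuous].
- under eq_fun do rewrite sinzN.
  apply: (@continuousN R R T).
  by apply: continuous_comp; [exact: cf|exact: sinz_continuous].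
Qed.

(** Hausdorffness is pulled back along continuous maps that separate points;
    this gives it for the circle and the torus from their coordinates. *)
Lemma cluster_map_eq (T U : topologicalType) (f : T -> U) (p q : T) :
  continuous f -> hausdorff_space U -> cluster (nbhs p) q -> f p = f q.
Proof.
move=> cf hU pq; apply: hU => A B /cf pA /cf qB.
by have [t [At Bt]] := pq _ _ pA qB; exists (f t).
Qed.

Lemma circle_hausdorff : hausdorff_space (circle R).
Proof.
move=> p q pq; apply: circle_eqP; apply: cluster_map_eq pq => //.
- exact: cosz_continuous.
- exact: sinz_continuous.
Qed.

Lemma torus_coord_continuous n (i : 'I_n) :
  continuous (fun v : torus R n => v ord0 i).
Proof.
move=> v A vA; exists (fun k j => if j == i then A else setT) => [k j|w /= h].
  by case: eqP => [->|_]; rewrite ?ord1//; exact: filterT.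
by have := h ord0 i; rewrite eqxx.
Qed.

Lemma continuous_torus (T : topologicalType) n (f : T -> torus R n) :
  (forall i, continuous (fun x => f x ord0 i)) -> continuous f.
Proof.
move=> cf x A [P fP PA]; rewrite /nbhs /=.
have : \forall y \near x, forall i, P ord0 i (f y ord0 i).
  by apply: filter_forall => i; apply: cf; exact: fP.
by apply: filterS => y Py; apply: PA => k i; rewrite (ord1 k).
Qed.

Lemma torus_hausdorff n : hausdorff_space (torus R n).
Proof.
move=> p q pq; apply/rowP => i.
apply: (@cluster_map_eq _ _ (fun v : torus R n => v ord0 i)) pq.
  exact: torus_coord_continuous.
exact: circle_hausdorff.
Qed.

Definition cis (t : R) : circle R := mk_circle (cos2Dsin2 t).

Lemma cosz_cis t : cosz (cis t) = cos t. Proof. by []. Qed.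
Lemma sinz_cis t : sinz (cis t) = sin t. Proof. by []. Qed.

Lemma cis_continuous : continuous cis.
Proof.
apply: continuous_circle => x.
- exact: continuous_cos.
- exact: continuous_sin.
Qed.

Lemma cisD s t : cis (s + t) = cis s + cis t.
Proof.
apply: circle_eqP; rewrite ?coszD ?sinzD !cosz_cis !sinz_cis ?cosD ?sinD//.
by rewrite addrC.
Qed.

Lemma cis0 : cis 0 = 0.
Proof. by apply: circle_eqP; rewrite /= ?cosz_cis ?sinz_cis ?cos0 ?sin0. Qed.

Lemma cisN t : cis (- t) = - cis t.
Proof. by apply/eqP; rewrite -addr_eq0 -cisD addNr cis0. Qed.

Lemma cisB s t : cis (s - t) = cis s - cis t.
Proof. by rewrite cisD cisN. Qed.

Lemma cis_2pi_int (k : int) : cis (k%:~R * (2 * pi)) = 0.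
Proof.
have c2 : cis (2 * pi) = 0.
  apply: circle_eqP; rewrite ?cosz_cis ?sinz_cis ?cosz0 ?sinz0 mulr_natl.
    by rewrite cos_mulr2n cospi; ring.
  by rewrite sin_mulr2n sinpi mulr0 mul0rn.
have H (m : nat) : cis (m%:R * (2 * pi)) = 0.
  by elim: m => [|m IH]; rewrite ?mul0r ?cis0// -natr1 mulrDl mul1r cisD IH c2 addr0.
case: k => m; first exact: H.
by rewrite NegzE mulrNz mulNr cisN H oppr0.
Qed.

Lemma cis_surj z : exists2 t, t \in `[- pi, pi] & cis t = z.
Proof.
have z1 := coszE2 z.
have cb : -1 <= cosz z <= 1.
  by have := sqr_ge0 (sinz z) => s0; apply/andP; split; nra.
have s : sin (acos (cosz z)) = `|sinz z|.
  by rewrite sin_acos// -sqrtr_sqr; congr (Num.sqrt _); rewrite -z1; ring.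
have a0 := acos_ge0 cb; have a1 := acos_lepi cb.
have ca : cos (acos (cosz z)) = cosz z by rewrite acosK// in_itv.
have [s0|s0] := leP 0 (sinz z).
- exists (acos (cosz z)); first by rewrite in_itv /= a1 andbT; lra.
  by apply: circle_eqP; rewrite ?cosz_cis ?sinz_cis ?ca ?s ?ger0_norm.
- exists (- acos (cosz z)); first by rewrite in_itv /=; apply/andP; split; lra.
  apply: circle_eqP; rewrite ?cosz_cis ?sinz_cis ?cosN ?sinN ?ca ?s ?ltr0_norm//.
  by rewrite opprK.
Qed.

(** Subtracting full turns brings t into one period, where the cosine takes the
    value 1 only at 0. *)
Lemma cis_eq0 t : cis t = 0 -> exists k : int, t = k%:~R * (2 * pi).
Proof.
move=> t0; have pi0 := pi_gt0 R; have p2 : 0 < 2 * pi :> R by rewrite mulr_gt0.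
pose k := Num.floor (t / (2 * pi)); exists k.
pose r := t - k%:~R * (2 * pi).
have r0 : cis r = 0 by rewrite cisB t0 cis_2pi_int subr0.
have rE : t = r + k%:~R * (2 * pi) by rewrite /r; ring.
have /andP[k1 k2] := floor_itv (t / (2 * pi)).
rewrite ler_pdivlMr// in k1; rewrite ltr_pdivrMr// intrD mulrDl mul1r -/k in k2.
have r1 : 0 <= r by rewrite subr_ge0.
have r2 : r < 2 * pi by rewrite ltrBlDl.
have cr : cos r = 1 by rewrite -cosz_cis r0.
suff : r = 0 by move=> /subr0_eq.
have [rp|rp] := leP r pi.
  by apply: (@cos_inj R); rewrite ?in_itv /= ?r1 ?rp ?lexx ?pi_ge0// cr cos0.
have : 2 * pi - r = 0.
  apply: (@cos_inj R); rewrite ?in_itv /= ?lexx ?pi_ge0//; last first.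
    by rewrite -cosN opprB cosB mulr_natl cos_mulr2n sin_mulr2n cospi sinpi cr cos0; ring.
  by apply/andP; split; lra.
by lra.
Qed.

(** A nonzero jump between two values congruent modulo 2 pi would, by the
    intermediate value theorem, force a value half a turn away from g 0. *)
Lemma continuous_2piZ_const (g : R -> R) :
  (forall s, 0 <= s <= 1 -> {for s, continuous g}) ->
  (forall s, 0 <= s <= 1 -> exists k : int, g s - g 0 = k%:~R * (2 * pi)) ->
  g 1 = g 0.
Proof.
move=> cg gk; have pi0 := pi_gt0 R.
have [|k kE] := gk 1; first by rewrite ler01 lexx.
have [k0|k0] := eqVneq k 0; first by move: kE; rewrite k0 mul0r => /subr0_eq.
pose v := g 0 + Num.sg k%:~R * pi.
have [||c cI cE] := @IVT R g 0 1 v ler01.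
- by apply: continuous_in_subspaceT => x; rewrite inE /= in_itv; exact: cg.
- have -> : g 1 = g 0 + k%:~R * (2 * pi) by rewrite -kE; ring.
  have [kp|kn] := ltP 0 k.
  + have k1 : 1 <= k%:~R :> R by rewrite ler1z -gtz0_ge1.
    have h : 2 * pi <= k%:~R * (2 * pi) :> R by rewrite ler_peMl// mulr_ge0// ltW.
    rewrite /v gtr0_sg ?ltr0z// mul1r; apply/andP; split.
      by rewrite ge_min; apply/orP; left; lra.
    by rewrite le_max; apply/orP; right; lra.
  + have k1 : k%:~R <= -1 :> R.
      by rewrite -[-1]/((-1)%:~R) ler_int; lia.
    have h : k%:~R * (2 * pi) <= - 1 * (2 * pi) :> R by rewrite ler_wpM2r// mulr_ge0// ltW.
    rewrite /v ltr0_sg ?ltrz0 ?lt_neqAle ?k0//; apply/andP; split.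
      by rewrite ge_min; apply/orP; right; lra.
    by rewrite le_max; apply/orP; left; lra.
- have [|j jE] := gk c; first by rewrite in_itv in cI.
  have : Num.sg k%:~R * pi = j%:~R * (2 * pi) :> R by rewrite -jE cE /v; ring.
  rewrite mulrA => /(mulIf (lt0r_neq0 pi0)).
  rewrite -(intr_sg R) -[2]/(2%:~R) -intrM => /intr_inj /(congr1 (fun x => `|x|%N)).
  rewrite abszM absz_sg k0 /= => /(congr1 odd); rewrite oddM andbF //.
Qed.

End Circle.

(** * Lifting circle-valued maps through the exponential *)
(** The complement of the preimage of an open set is the image under q of a
    closed part of K, hence compact, hence closed. *)
Lemma continuous_of_compact_quotient (A B C : topologicalType) (q : A -> B) (K : set A)
    (f : B -> C) : compact K -> continuous q -> hausdorff_space B ->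
  (forall b, exists2 a, K a & q a = b) -> continuous (f \o q) -> continuous f.
Proof.
move=> cK cq hB qs cfq; apply/continuousP => O oO.
rewrite -[X in open X]setCK openC.
have -> : ~` (f @^-1` O) = q @` (K `&` ~` ((f \o q) @^-1` O)).
  apply/seteqP; split=> [b nO|b [a [Ka nO] <-]] //.
  by have [a Ka ab] := qs b; exists a => //; split=> //; rewrite /= ab.
apply: compact_closed => //; apply: continuous_compact.
  exact: continuous_subspaceT.
apply: compact_closedI => //; apply: open_closedC.
by move/continuousP: cfq; apply.
Qed.

Section Lift.
Variables (R : realType).
Implicit Types z w : circle R.

Definition arg z : R := asin (sinz z).

Lemma sinz_itv z : 0 < cosz z -> -1 < sinz z < 1.
Proof. by have := coszE2 z => h c; apply/andP; split; nra. Qed.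

Lemma arg_continuous z : 0 < cosz z -> {for z, continuous arg}.
Proof.
move=> cz; apply: continuous_comp; first exact: sinz_continuous.
by apply: continuous_asin; exact: sinz_itv.
Qed.

Lemma cis_arg z : 0 < cosz z -> cis (arg z) = z.
Proof.
move=> c; have /andP[s1 s2] := sinz_itv c.
have s3 : -1 <= sinz z <= 1 by rewrite !ltW.
apply: circle_eqP; rewrite ?cosz_cis ?sinz_cis; last by rewrite asinK// in_itv.
rewrite cos_asin// -[RHS]ger0_norm ?ltW// -sqrtr_sqr; congr (Num.sqrt _).
by rewrite -(coszE2 z); ring.
Qed.

Variables (V : normedModType R) (phi : V -> circle R).
Hypothesis cphi : continuous phi.

(** Step d is fine at t when phi turns by less than a quarter circle between a
    point of the segment from 0 to t and any point of the line through it that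
    is d-close in the parameter; the principal argument of each step quotient is
    then continuous. *)
Let fine_at (d : R) (t : V) := forall s s' : R, 0 <= s <= 1 ->
  `|s - s'| < d -> 0 < cosz (phi (s' *: t) - phi (s *: t)).

Let step (M : nat) (t : V) (j : nat) : circle R :=
  phi ((j.+1%:R / M%:R) *: t) - phi ((j%:R / M%:R) *: t).

Let ray_lift (M : nat) (t : V) : R := \sum_(j < M) arg (step M t j).

(** Compactness of the parameter interval gives one step size valid for all
    endpoints near t0. *)
Let fine_tube (t0 : V) : exists2 d : R, 0 < d & \forall t \near t0, fine_at d t.
Proof.
pose W (p : R * (R * V)) := cosz (phi (p.1 *: p.2.2) - phi (p.2.1 *: p.2.2)).
have cW : continuous W.
  move=> p; apply: (@continuous_comp _ _ _
    (fun p : R * (R * V) => phi (p.1 *: p.2.2) - phi (p.2.1 *: p.2.2)));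
    last exact: cosz_continuous.
  apply: continuous_circleD; last apply: continuous_circleN => {}p.
    move=> {}p; apply: continuous_comp; last exact: cphi.
    apply: (@continuousZ R V); first exact: cvg_fst.
    by apply: continuous_comp; [exact: cvg_snd|exact: cvg_snd].
  apply: continuous_comp; last exact: cphi.
  apply: (@continuousZ R V).
    by apply: continuous_comp; [exact: cvg_snd|exact: cvg_fst].
  by apply: continuous_comp; [exact: cvg_snd|exact: cvg_snd].
have [seg _] := compact_near_coveringP `[0, 1 : R]%classic.
have := seg (@segment_compact R 0 1) (V * R)%type
  (filter_prod (nbhs t0) (nbhs (0 : R)))
  (fun td s => forall s', `|s - s'| < td.2 ->
     0 < cosz (phi (s' *: td.1) - phi (s *: td.1))) _.
case=> [s0 _|[T D] /= [Tt0 /nbhs_ballP[e /= e0 De]] TD].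
  have : \forall p \near (s0, (s0, t0)), 0 < W p.
    by apply: cvgr_gt (cW (s0, (s0, t0))) _ _; rewrite /W /= subrr cosz0.
  move=> [[A B] /= [/nbhs_ballP[e /= e0 Ae] [[C D] [Cs0 Dt0] CDB]] AB].
  have e2 : 0 < e / 2 by rewrite divr_gt0.
  exists (C `&` ball s0 (e / 2), D `*` ball 0 (e / 2)) => /=.
    split; first by apply: filterI => //; exact: nbhsx_ballx.
    by exists (D, ball 0 (e / 2)) => //; split=> //; exact: nbhsx_ballx.
  move=> [s [t d]] /= [[Cs s0s] [Dt d0]] s' ss'; apply: (AB (s', (s, t))).
  split; last exact: CDB.
  apply: Ae; rewrite /ball /= in s0s d0 *.
  rewrite sub0r normrN in d0; have := ler_norm d => dd.
  rewrite (_ : s0 - s' = (s0 - s) + (s - s')); last by ring.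
  by apply: le_lt_trans (ler_normD _ _) _; lra.
exists (e / 2); first by rewrite divr_gt0.
apply: filterS Tt0 => t Tt s s' s01 ss'.
apply: (TD (t, e / 2)) => //=; split=> //=.
apply: De; rewrite /ball /= sub0r normrN gtr0_norm ?divr_gt0//; lra.
Qed.

Let fine_step d M t s j : fine_at d t -> M%:R^-1 < d -> 0 <= s <= 1 ->
  (j < M)%N -> 0 < cosz (step M (s *: t) j).
Proof.
move=> fd Md s01 jM; rewrite /step !scalerA; apply: fd.
  have M0 : 0 < M%:R :> R by rewrite ltr0n; case: M jM {Md}.
  have /andP[s0 s1] := s01; apply/andP; split.
    by rewrite mulr_ge0// divr_ge0.
  by rewrite mulr_ile1// ?divr_ge0// ler_pdivrMr// mul1r ler_nat ltnW.
apply: le_lt_trans Md; rewrite -!mulrBl -natr1 opprD addrA subrr sub0r mulN1r mulNr normrN.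
have /andP[s0 s1] := s01.
by rewrite ger0_norm ?mulr_ge0// ler_piMr.
Qed.

Let cis_ray_lift d M t s : fine_at d t -> M%:R^-1 < d -> (0 < M)%N -> 0 <= s <= 1 ->
  cis (ray_lift M (s *: t)) = phi (s *: t) - phi 0.
Proof.
move=> fd Md M0 s01.
have -> : cis (ray_lift M (s *: t)) = \sum_(j < M) step M (s *: t) j.
  rewrite /ray_lift (big_morph (@cis R) (@cisD R) (@cis0 R)).
  by apply: eq_bigr => j _; rewrite cis_arg//; exact: fine_step Md s01 _.
rewrite -(big_mkord xpredT (fun j => step M (s *: t) j)) /step.
rewrite (telescope_sumr (fun j => phi ((j%:R / M%:R) *: (s *: t))))//.
by rewrite mul0r scale0r divff ?scale1r// pnatr_eq0 -lt0n.
Qed.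

Let ray_lift_continuous d M t s : fine_at d t -> M%:R^-1 < d -> 0 <= s <= 1 ->
  {for s *: t, continuous (ray_lift M)}.
Proof.
move=> fd Md s01; apply: cvg_big => [|j _]; first exact: add_continuous.
apply: (@continuous_comp _ _ _ (fun t => step M t j) arg); last first.
  by apply: arg_continuous; exact: fine_step Md s01 _.
apply: continuous_circleD; last apply: continuous_circleN;
  move=> u; apply: continuous_comp; try exact: cphi; exact: scaler_continuous.
Qed.

Let ray_lift0 M : ray_lift M 0 = 0.
Proof.
rewrite /ray_lift big1// => j _; rewrite /step !scaler0 subrr /arg sinz0.
by rewrite -[RHS]sinK ?sin0// in_itv /= oppr_le0 divr_ge0 ?pi_ge0.
Qed.

(** Along the segment the two candidates differ by a continuous function with
    values in 2 pi Z that vanishes at 0. *)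
Let ray_lift_unique d d' M M' t : fine_at d t -> M%:R^-1 < d -> (0 < M)%N ->
  fine_at d' t -> M'%:R^-1 < d' -> (0 < M')%N -> ray_lift M t = ray_lift M' t.
Proof.
move=> fd Md M0 fd' Md' M0'.
pose g s := ray_lift M (s *: t) - ray_lift M' (s *: t).
suff : g 1 = g 0.
  rewrite /g !scale1r !scale0r => /eqP; rewrite subr_eq => /eqP ->.
  by rewrite !ray_lift0 subrr add0r.
apply: continuous_2piZ_const => // [s s01|s s01].
  apply: (@continuousB R R R).
  - apply: (@continuous_comp R V R (fun s => s *: t) (ray_lift M)).
      exact: scalel_continuous.
    exact: ray_lift_continuous Md s01.
  - apply: (@continuous_comp R V R (fun s => s *: t) (ray_lift M')).
      exact: scalel_continuous.
    exact: ray_lift_continuous Md' s01.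
have -> : g s - g 0 = ray_lift M (s *: t) - ray_lift M' (s *: t).
  by rewrite /g scale0r !ray_lift0 !subr0.
by apply: cis_eq0; rewrite cisB (cis_ray_lift fd)// (cis_ray_lift fd')// subrr.
Qed.

(** Adding the principal arguments of the step quotients along the segment from
    0 to t lifts phi. The sum does not depend on the number of steps once they
    are fine, so formulas with a locally constant number of steps glue to a
    continuous function. *)
Lemma continuous_lift :
  exists2 H : V -> R, continuous H & forall t, phi t = phi 0 + cis (H t).
Proof.
have fineM (t : V) : exists dM : R * nat,
    [/\ \forall u \near t, fine_at dM.1 u, dM.2%:R^-1 < dM.1 & (0 < dM.2)%N].
  have [d d0 ft] := fine_tube t.
  exists (d, (Num.bound d^-1).+1); split => //=.
  rewrite invf_plt ?posrE//; apply: lt_le_trans (archi_boundP _) _.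
    by rewrite invr_ge0 ltW.
  by rewrite ler_nat.
have [dM dMP] := choice fineM.
exists (fun t => ray_lift (dM t).2 t) => [t|t]; last first.
  have [ft Md M0] := dMP t.
  have := cis_ray_lift (nbhs_singleton ft) Md M0 (_ : 0 <= 1 <= 1).
  by rewrite !scale1r ler01 lexx => ->//; rewrite addrC subrK.
have [ft Md M0] := dMP t.
have ct : {for t, continuous (ray_lift (dM t).2)}.
  have := ray_lift_continuous (nbhs_singleton ft) Md (_ : 0 <= 1 <= 1).
  by rewrite !scale1r ler01 lexx; apply.
apply: cvg_trans ct; apply: near_eq_cvg.
apply: filterS ft => u fu; have [fu' Md' M0'] := dMP u.
exact: ray_lift_unique fu Md M0 (nbhs_singleton fu') Md' M0'.
Qed.

End Lift.

(** * Degrees of circle-valued maps on the torus *)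
Lemma flow_act_continuous (G : topologicalZmodType) (K : topologicalType)
  (X : flow G K) g : continuous (X g).
Proof.
move=> x; apply: (@continuous_comp _ _ _ (fun x => (g, x)) (fun p => X p.1 p.2)).
  by apply: cvg_pair => /=; [exact: cvg_cst|exact: cvg_id].
exact: act_continuous.
Qed.

Section Torus.
Variables (R : realType) (n : nat).
Notation V := 'rV[R]_n.
Implicit Types (psi : torus R n -> circle R) (k : 'rV[int]_n).

Definition expT (t : V) : torus R n := \row_i cis (t ord0 i).

Lemma expTD s t : expT (s + t) = expT s + expT t.
Proof. by apply/rowP => i; rewrite !mxE cisD. Qed.

Lemma expT0 : expT 0 = 0.
Proof. by apply/rowP => i; rewrite !mxE cis0. Qed.

Lemma expTB s t : expT (s - t) = expT s - expT t.
Proof. by apply/rowP => i; rewrite !mxE cisB. Qed.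

Lemma expT_continuous : continuous expT.
Proof.
apply: continuous_torus => i; rewrite /expT; under eq_fun do rewrite mxE.
move=> t; apply: (@continuous_comp _ _ _ (fun t : V => t ord0 i) (@cis R)).
  exact: coord_continuous.
exact: cis_continuous.
Qed.

Let box : set V := [set t | forall i, `[- pi, pi : R]%classic (t ord0 i)].

Let box_compact : compact box.
Proof. by apply: (@rV_compact _ _ (fun=> `[- pi, pi : R]%classic)) => i; exact: segment_compact. Qed.

Lemma expT_surj x : exists2 t, box t & expT t = x.
Proof.
have /choice[t tP] : forall i, exists t : R, t \in `[- pi, pi] /\ cis t = x ord0 i.
  by move=> i; have [t tI tx] := cis_surj (x ord0 i); exists t.
exists (\row_i t i); first by move=> i; rewrite mxE; have [] := tP i.
by apply/rowP => i; rewrite !mxE; have [] := tP i.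
Qed.

(** Generators of the kernel of the covering map. *)
Let e_ (i : 'I_n) : V := (2 * pi) *: delta_mx ord0 i.

Lemma expT_eq0 t : expT t = 0 -> exists v : 'I_n -> int, t = \sum_i (e_ i *~ v i).
Proof.
move=> t0; have /choice[v vP] : forall i, exists k : int, t ord0 i = k%:~R * (2 * pi).
  by move=> i; apply: cis_eq0; have := congr1 (fun x : torus R n => x ord0 i) t0; rewrite !mxE; apply.
exists v; rewrite [LHS]row_sum_delta; apply: eq_bigr => i _.
by rewrite vP /e_ scalerMzl mulrzl.
Qed.

Lemma expT_e i : expT (e_ i) = 0.
Proof.
apply/rowP => j; rewrite !mxE eqxx /=; case: eqP => _; last by rewrite mulr0 cis0.
by have := cis_2pi_int R 1; rewrite mul1r mulr1.
Qed.

Lemma rV_2piZ_const (f : V -> R) : continuous f ->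
  (forall t, exists j : int, f t - f 0 = j%:~R * (2 * pi)) -> forall t, f t = f 0.
Proof.
move=> cf fj t; rewrite -[in LHS](scale1r t) -[in RHS](scale0r t).
apply: (@continuous_2piZ_const R (fun s => f (s *: t))) => s _.
  apply: (@continuous_comp R V R (fun s => s *: t) f); last exact: cf.
  exact: scalel_continuous.
by rewrite scale0r.
Qed.

(** A relation rather than a function, so that additivity and uniqueness can be
    proved without choosing lifts. *)
Definition has_degree psi k := exists H : V -> R,
  [/\ continuous H, forall t, psi (expT t) = psi 0 + cis (H t)
    & forall t i, H (t + e_ i) = H t + (k ord0 i)%:~R * (2 * pi)].

(** For a lift H, the function H (t + e_ i) - H t takes values in 2 pi Z on a
    connected space, so it is constant. *)
Lemma degree_exists psi : continuous psi -> exists k, has_degree psi k.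
Proof.
move=> cpsi; have [|H cH HE] := @continuous_lift R V (psi \o expT).
  by move=> t; apply: continuous_comp; [exact: expT_continuous|exact: cpsi].
have HP i t : exists j : int, H (t + e_ i) - H t = j%:~R * (2 * pi).
  apply: cis_eq0; apply: (addrI (psi (expT 0))).
  rewrite cisB addrA -HE /= expTD expT_e addr0 addr0.
  by rewrite [psi (expT t)]HE /= addrK.
have /choice[k kP] := fun i => HP i 0.
exists (\row_i k i), H; split => // [t|t i].
  by rewrite [LHS]HE /= expT0.
have := @rV_2piZ_const (fun t => H (t + e_ i) - H t) _ _ t.
rewrite /= (kP i) mxE => <-; first by rewrite [RHS]addrC subrK.
- move=> u; apply: (@continuousB R R V); last exact: cH.
  apply: (@continuous_comp V V R (fun u => u + e_ i) H); last exact: cH.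
  apply: continuousD; [by move=> A|exact: cst_continuous].
- move=> u; have [j jE] := HP i u; have [j' jE'] := HP i 0.
  by exists (j - j'); rewrite intrB mulrBl -jE -jE' (kP i).
Qed.

Lemma has_degreeD psi psi' k k' : has_degree psi k -> has_degree psi' k' ->
  has_degree (fun x => psi x + psi' x) (k + k').
Proof.
move=> [H [cH HE HP]] [H' [cH' HE' HP']]; exists (fun t => H t + H' t); split.
- by move=> t; apply: (@continuousD R R V); [exact: cH|exact: cH'].
- by move=> t; rewrite HE HE' cisD addrACA.
- by move=> t i; rewrite HP HP' mxE intrD; ring.
Qed.

Lemma has_degreeN psi k : has_degree psi k -> has_degree (fun x => - psi x) (- k).
Proof.
move=> [H [cH HE HP]]; exists (fun t => - H t); split.
- by move=> t; apply: (@continuousN R R V); exact: cH.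
- by move=> t; rewrite HE cisN opprD.
- by move=> t i; rewrite HP mxE intrN; ring.
Qed.

Lemma has_degree_cst a : has_degree (fun _ => a) 0.
Proof.
exists (fun _ => 0); split; first exact: cst_continuous.
  by move=> t; rewrite cis0 addr0.
by move=> t i; rewrite mxE mul0r addr0.
Qed.

Lemma degree_cst a k : has_degree (fun _ => a) k -> k = 0.
Proof.
move=> [H [cH HE HP]]; apply/rowP => i; rewrite mxE.
have cH0 t : cis (H t) = 0 by apply: (addrI a); rewrite -HE addr0.
have Hc t : H t = H 0.
  by apply: (rV_2piZ_const cH) => {}t; apply: cis_eq0; rewrite cisB !cH0 subrr.
have := HP 0 i; rewrite !Hc -[X in X = _]addr0 => /addrI/esym/eqP; rewrite mulf_eq0.
by rewrite intr_eq0 (gt_eqF (mulr_gt0 _ (pi_gt0 R)))// orbF => /eqP.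
Qed.

Lemma has_degreeMz psi k (c : int) : has_degree psi k ->
  has_degree (fun x => psi x *~ c) (k *~ c).
Proof.
move=> dk; have Mn m : has_degree (fun x => psi x *+ m) (k *+ m).
  elim: m => [|m IH]; first exact: has_degree_cst.
  rewrite mulrS (_ : (fun x => _) = (fun x => psi x + psi x *+ m)); first exact: has_degreeD.
  by apply/funext => x; rewrite mulrS.
case: c => m; first exact: Mn.
rewrite NegzE mulrNz (_ : (fun x => _) = (fun x => - (psi x *+ m.+1))).
  exact: has_degreeN.
by apply/funext => x; rewrite mulrNz.
Qed.

Lemma has_degree_sum (I : Type) (r : seq I) (F : I -> torus R n -> circle R)
    (k : I -> 'rV[int]_n) : (forall i, has_degree (F i) (k i)) ->
  has_degree (fun x => \sum_(i <- r) F i x) (\sum_(i <- r) k i).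
Proof.
move=> dF; elim: r => [|i r IH].
  rewrite big_nil (_ : (fun x => _) = (fun _ => 0)); first exact: has_degree_cst.
  by apply/funext => x; rewrite big_nil.
rewrite big_cons (_ : (fun x => _) = (fun x => F i x + \sum_(i <- r) F i x)).
  exact: has_degreeD.
by apply/funext => x; rewrite big_cons.
Qed.

(** A lift of degree 0 is invariant under the whole kernel of the covering, so
    it descends; continuity of the descended function is checked on a compact
    fundamental box. *)
Lemma degree0_log psi : has_degree psi 0 ->
  exists2 h : torus R n -> R, continuous h & forall x, psi x = psi 0 + cis (h x).
Proof.
move=> [H [cH HE HP]].
pose per w := forall t, H (t + w) = H t.
have perD w w' : per w -> per w' -> per (w + w').
  by move=> a b t; rewrite addrA b a.
have perN w : per w -> per (- w) by move=> a t; rewrite -[in RHS](subrK w t) a.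
have per0 : per 0 by move=> t; rewrite addr0.
have perMn w m : per w -> per (w *+ m).
  by move=> a; elim: m => [|m IH]; rewrite ?mulr0n// mulrS; exact: perD.
have perMz w j : per w -> per (w *~ j).
  by case: j => m a; rewrite ?NegzE ?mulrNz; [|apply: perN]; exact: perMn.
have pere i : per (e_ i) by move=> t; rewrite HP mxE mul0r addr0.
have Hexp t t' : expT t = expT t' -> H t = H t'.
  move=> tt'; have [v vE] : exists v : 'I_n -> int, t - t' = \sum_i (e_ i *~ v i).
    by apply: expT_eq0; rewrite expTB tt' subrr.
  rewrite -[t](subrK t') vE addrC.
  suff : per (\sum_i (e_ i *~ v i)) by exact.
  by elim/big_ind: _ => // i _; exact: perMz.
have /choice[s sP] : forall x, exists t, expT t = x.
  by move=> x; have [t _] := expT_surj x; exists t.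
exists (fun x => H (s x)) => [|x]; last by rewrite -HE sP.
apply: (@continuous_of_compact_quotient V (torus R n) R expT box (H \o s)) => //.
- exact: expT_continuous.
- exact: torus_hausdorff.
- exact: expT_surj.
- rewrite (_ : _ \o _ = H)//; apply/funext => t /=; apply: Hexp; exact: sP.
Qed.

(** The increment of h under g has all its values in one coset of 2 pi Z, so it
    is constant. It is nonpositive at a maximum of h and nonnegative at a
    minimum, so it vanishes. *)
Lemma eigen_degree0_invariant (G : topologicalZmodType) (X : flow G (torus R n))
    psi (h : torus R n -> R) :
  (forall g, exists a, forall x, psi (X g x) = a + psi x) ->
  continuous h -> (forall x, psi x = psi 0 + cis (h x)) -> invariant_function X h.
Proof.
move=> eig ch hE g.
have [a aE] := eig g.
pose D x := h (X g x) - h x.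
have cD : continuous D.
  move=> x; apply: (@continuousB R R _); last exact: ch.
  by apply: continuous_comp; [exact: flow_act_continuous|exact: ch].
have cisD_ x : cis (D x) = a.
  have := aE x; rewrite hE [psi x]hE /D cisB => /eqP.
  by rewrite addrCA => /eqP/addrI ->; rewrite addrK.
have Dc x : D x = D 0.
  have [t _ <-] := expT_surj x; rewrite -expT0.
  apply: (@rV_2piZ_const (D \o expT)) => [{}t|{}t].
    by apply: continuous_comp; [exact: expT_continuous|exact: cD].
  by apply: cis_eq0; rewrite cisB /= !cisD_ subrr.
have T0 : [set: torus R n] !=set0 by exists 0.
have cw := @continuous_subspaceT _ _ [set: torus R n] _ ch.
have [M _ Mmax] := compact_EVT_max T0 (flow_compact X) cw.
have [m _ mmin] := compact_EVT_min T0 (flow_compact X) cw.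
have D1 : D M <= 0 by rewrite subr_le0; apply: Mmax; rewrite inE.
have D2 : 0 <= D m by rewrite subr_ge0; apply: mmin; rewrite inE.
move=> x; apply/eqP; rewrite -subr_eq0 -/(D x) eq_le.
by rewrite (Dc x) -{1}(Dc M) D1 -(Dc m) D2.
Qed.

End Torus.

(** * Subgroups of the integer lattice *)
(** Induction on the number j of coordinates allowed to be nonzero. Among the
    vectors of S that only use the first j + 1 coordinates, one whose last
    coordinate has least positive absolute value completes a basis: division
    with remainder by that coordinate reduces every other vector to the case j. *)
Lemma int_lattice_basis n (S : 'rV[int]_n -> Prop) :
  S 0 -> (forall u v, S u -> S v -> S (u + v)) -> (forall u, S u -> S (- u)) ->
  exists m (B : 'I_m -> 'rV[int]_n), [/\ (m <= n)%N, forall i, S (B i),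
    forall v, S v -> exists c : 'I_m -> int, v = \sum_i B i *~ c i
    & forall c : 'I_m -> int, \sum_i B i *~ c i = 0 -> forall i, c i = 0].
Proof.
move=> S0 SD SN.
have SMn u k : S u -> S (u *+ k).
  by move=> Su; elim: k => [|k IH]; rewrite ?mulr0n// mulrS; exact: SD.
have SMz u k : S u -> S (u *~ k).
  by move=> Su; case: k => k; rewrite ?NegzE ?mulrNz; [|apply: SN]; exact: SMn.
have coordMz (u : 'rV[int]_n) k i : (u *~ k) ord0 i = u ord0 i * k.
  rewrite -scaler_int mxE mulrC; congr (_ * _); exact: intz.
suff H j : (j <= n)%N -> exists m (B : 'I_m -> 'rV[int]_n),
    [/\ (m <= j)%N, forall i, S (B i) /\ (forall l : 'I_n, (j <= l)%N -> B i ord0 l = 0),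
    forall v, S v -> (forall l : 'I_n, (j <= l)%N -> v ord0 l = 0) ->
      exists c : 'I_m -> int, v = \sum_i B i *~ c i
    & forall c : 'I_m -> int, \sum_i B i *~ c i = 0 -> forall i, c i = 0].
  have [m [B [mn SB span free]]] := H n (leqnn n).
  exists m, B; split => // [i|v Sv]; first by have [] := SB i.
  by apply: span => // l; rewrite leqNgt ltn_ord.
elim: j => [_|j IH jn].
  exists 0%N, (fun _ => 0); split => // [i|v _ v0|c _ []//]; first by case: i.
  by exists (fun _ => 0); rewrite big_ord0; apply/rowP => l; rewrite v0// mxE.
have [m [B [mj SB span free]]] := IH (ltnW jn).
pose oj := Ordinal jn.
pose S' v := S v /\ forall l : 'I_n, (j < l)%N -> v ord0 l = 0.
have [all0|] := pselect (forall v, S' v -> v ord0 oj = 0).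
  exists m, B; split => // [|i|v Sv v0].
  - exact: leqW.
  - have [SBi Bi] := SB i; split=> // l jl; exact: Bi (ltnW jl).
  - apply: span => // l; rewrite leq_eqVlt => /orP[/eqP jl|]; last exact: v0.
    by rewrite (_ : l = oj) ?all0//; apply: val_inj.
move=> /existsNP[w /not_implyP[S'w wj]].
pose P k := `[< exists v, S' v /\ `|v ord0 oj|%N = k.+1 >].
have exP : exists k, P k.
  exists `|w ord0 oj|.-1; apply/asboolP; exists w; split=> //.
  by rewrite prednK// absz_gt0; apply/eqP.
have [k /asboolP[v0 [S'v0 v0k]] kmin] := ex_minnP exP.
have v0n : v0 ord0 oj != 0 by rewrite -absz_eq0 v0k.
(* The remainder is the last coordinate of a smaller vector of S unless it is
   0. *)
have quo v : S' v -> exists q : int, v ord0 oj = v0 ord0 oj * q.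
  move=> [Sv vl]; exists (v ord0 oj %/ v0 ord0 oj)%Z.
  have := divz_eq (v ord0 oj) (v0 ord0 oj).
  set q := (_ %/ _)%Z; set r := (_ %% _)%Z => dE.
  have r0 : 0 <= r by exact: modz_ge0.
  have rk : r < `|v0 ord0 oj| by exact: ltz_mod.
  have [r00|rn0] := eqVneq r 0; first by rewrite dE r00 addr0 mulrC.
  have : P `|r|.-1.
    apply/asboolP; exists (v - v0 *~ q); split; last first.
      by rewrite !mxE coordMz dE prednK ?absz_gt0//; congr absz; ring.
    split; first by apply: SD => //; apply: SN; apply: SMz; case: S'v0.
    by move=> l jl; rewrite !mxE coordMz vl// (S'v0.2 l jl) mul0r subr0.
  move=> /kmin; lia.
exists m.+1, (fun i => if unlift ord0 i is Some i' then B i' else v0); split.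
- exact: mj.
- move=> i; case: unliftP => [i' _|_]; last by case: S'v0.
  by have [SBi Bi] := SB i'; split=> // l jl; exact: Bi (ltnW jl).
- move=> v Sv vl; have [q qE] := quo v (conj Sv vl).
  have [|l jl|c cE] := span (v - v0 *~ q).
  + by apply: SD => //; apply: SN; apply: SMz; case: S'v0.
  + move: jl; rewrite leq_eqVlt !mxE coordMz => /orP[/eqP jl|jl].
      by rewrite (_ : l = oj) ?qE ?subrr//; apply: val_inj.
    by rewrite vl// (S'v0.2 l jl) mul0r subr0.
  exists (fun i => if unlift ord0 i is Some i' then c i' else q).
  rewrite big_ord_recl unlift_none; under eq_bigr do rewrite liftK.
  by rewrite -cE addrC subrK.
- move=> c; rewrite big_ord_recl unlift_none; under eq_bigr do rewrite liftK.
  move=> c0.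
  have c00 : c ord0 = 0.
    have := congr1 (fun v : 'rV[int]_n => v ord0 oj) c0.
    rewrite !mxE coordMz summxE big1 ?addr0; last first.
      by move=> i _; rewrite coordMz (SB i).2 ?mul0r.
    by move=> /eqP; rewrite mulf_eq0 (negbTE v0n) => /eqP.
  move: c0; rewrite c00 mulr0z add0r => /(free (fun i => c (lift ord0 i))) c0 i.
  by case: (unliftP ord0 i) => [i' ->|->].
Qed.

(** * Moduli of continuity, orbit suprema and invariant pseudometrics *)
Section Real.
Variable R : realType.

Lemma sup_dist_le (I : Type) (i0 : I) (a b : I -> R) B e :
  (forall i, a i <= B) -> (forall i, b i <= B) -> (forall i, `|a i - b i| <= e) ->
  `|sup (range a) - sup (range b)| <= e.
Proof.
have half (a' b' : I -> R) : (forall i, b' i <= B) -> (forall i, `|a' i - b' i| <= e) ->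
    sup (range a') <= sup (range b') + e.
  move=> bB ab; apply: ge_sup; first by exists (a' i0); exists i0.
  move=> _ [i _ <-]; have := ab i; rewrite ler_norml => /andP[_].
  rewrite lerBlDl => /le_trans; apply; rewrite lerD2r.
  by apply: ub_le_sup; [exists B => _ [j _ <-]|exists i].
move=> aB bB ab; rewrite ler_norml; apply/andP; split.
  by rewrite lerBrDl lerBlDr; apply: half => // i; rewrite distrC.
by rewrite lerBlDl; apply: half.
Qed.

Lemma range_sup_ge (I : Type) (a : I -> R) B i : (forall i, a i <= B) -> a i <= sup (range a).
Proof. by move=> aB; apply: ub_le_sup; [exists B => _ [j _ <-]|exists i]. Qed.

Lemma range_sup_le (I : Type) (i0 : I) (a : I -> R) B : (forall i, a i <= B) -> sup (range a) <= B.
Proof. by move=> aB; apply: ge_sup; [exists (a i0); exists i0|move=> _ [i _ <-]]. Qed.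

Lemma continuous_bounded (K : topologicalType) (f : K -> R) : compact [set: K] ->
  continuous f -> exists2 B, 0 < B & forall x, `|f x| <= B.
Proof.
move=> cK cf; have [K0|/set0P K0] := eqVneq [set: K] set0.
  by exists 1 => // x; have : [set: K] x by []; rewrite K0.
have cn : continuous (fun x => `|f x|).
  by move=> x; apply: continuous_comp; [exact: cf|exact: norm_continuous].
have [c _ cmax] := compact_EVT_max K0 cK (continuous_subspaceT cn).
exists (`|f c| + 1); first by rewrite ltr_wpDl.
by move=> x; apply: le_trans (cmax x _) _; rewrite ?inE// lerDl.
Qed.

Definition has_modulus (L : uniformType) (f : L -> R) := forall e, 0 < e ->
  exists2 D : set (L * L), entourage D & forall x y, D (x, y) -> `|f x - f y| <= e.

(** The Heine theorem, with the filter of small entourages in the role of the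
    step size. *)
Lemma continuous_has_modulus (L : uniformType) (f : L -> R) : compact [set: L] ->
  continuous f -> has_modulus f.
Proof.
move=> /compact_near_coveringP cL cf e e0.
have [L0|/set0P[x0 _]] := eqVneq [set: L] set0.
  exists setT; first exact: entourageT.
  by move=> x; have : [set: L] x by []; rewrite L0.
have entP : ProperFilter (@entourage L).
  apply: Build_ProperFilter_ex => A entA; exists (x0, x0).
  exact: entourage_refl.
have := cL _ (powerset_filter_from (@entourage L))
  (fun D x => forall y, D (x, y) -> `|f x - f y| <= e)
  (powerset_filter_from_filter entP).
case=> [x _|/= A [AD _ [D DA]] Acov]; last first.
  by exists D; [exact: AD|move=> x y; exact: Acov].
have e2 : 0 < e / 2 by rewrite divr_gt0.
have : \forall y \near x, `|f x - f y| < e / 2 by apply: (@cvgr_dist_lt _ R _ _ _ _ _ (cf x)).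
move=> /nbhsP[E entE Ef].
exists (xsection (split_ent E) x, [set D | entourage D /\ D `<=` split_ent E]) => /=.
  split; first exact: nbhs_entourage.
  exists [set D | entourage D /\ D `<=` split_ent E] => //; split.
  - by move=> D [].
  - by move=> C D' [entC CE] entD' D'C; split => //; exact: subset_trans CE.
  - by exists (split_ent E); split => //; exact: entourage_split_ent.
move=> [z D] /= [/xsectionP xz [_ DE]] y /DE zy.
have xy : E (x, y) by apply: (entourage_split z).
have xz' : E (x, z) by exact: split_ent_subset.
rewrite (_ : f z - f y = (f x - f y) - (f x - f z)); last by ring.
apply: le_trans (ler_normB _ _) _; rewrite [leRHS]splitr.
by apply/lerD; apply/ltW/Ef/xsectionP.
Qed.

Lemma has_modulus_continuous (L : uniformType) (f : L -> R) : has_modulus f ->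
  continuous f.
Proof.
move=> mf x; apply/(@cvgrPdist_le _ R L _ (nbhs_filter x)) => e /mf[D entD Df].
by near=> y; apply: Df; apply/xsectionP; near: y; exact: nbhs_entourage.
Unshelve. all: by end_near. Qed.

End Real.

Lemma eq_range (S T : Type) (F F' : S -> T) : F =1 F' -> range F = range F'.
Proof. by move=> /funext ->. Qed.

Section Equi.
Variables (R : realType) (G : topologicalZmodType) (L : uniformType) (Y : flow G L).
Hypothesis Yeq : equicontinuous_flow Y.

Lemma flow_actA g h x : Y g (Y h x) = Y (g + h) x.
Proof. by rewrite actD. Qed.

(** Equicontinuity turns uniform continuity of f into a modulus common to all
    its translates; every continuity statement about suprema over the orbit
    rests on it. *)
Lemma orbit_sup_equi (f : L -> R) : continuous f -> forall e, 0 < e ->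
  exists2 D : set (L * L), entourage D &
    forall g x y, D (x, y) -> `|f (Y g x) - f (Y g y)| <= e.
Proof.
move=> cf e e0.
have [E entE Ef] := continuous_has_modulus (flow_compact Y) cf e0.
by have [D entD DE] := Yeq entE; exists D => // g x y /DE-/(_ g)/Ef.
Qed.

Definition orbit_sup (f : L -> R) x := sup (range (fun g => f (Y g x))).

Lemma range_translate (T : Type) (F : G -> T) h : range (fun g => F (g + h)) = range F.
Proof.
apply/seteqP; split=> _ [g _ <-]; first by exists (g + h).
by exists (g - h) => //; rewrite subrK.
Qed.

Lemma orbit_sup_invariant f : invariant_function Y (orbit_sup f).
Proof.
move=> h x; rewrite /orbit_sup; congr sup.
rewrite -(range_translate (fun g => f (Y g x)) h).
by apply: eq_range => g; rewrite flow_actA.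
Qed.

Lemma orbit_sup_continuous f : continuous f -> continuous (orbit_sup f).
Proof.
move=> cf; apply: has_modulus_continuous => e e0.
have [B _ fB] := continuous_bounded (flow_compact Y) cf.
have fB' x : f x <= B by apply: le_trans (fB x); exact: ler_norm.
have [D entD Df] := orbit_sup_equi cf e0; exists D => // x y Dxy.
by apply: (@sup_dist_le R _ 0 _ _ B) => // g; exact: Df.
Qed.

(** If the orbit of x misses an open set around y, then the orbit supremum of a
    bump function living on that set is a continuous invariant function with
    different values at x and y. *)
Lemma minimal_of_invariant_const :
  (forall f : L -> R, continuous f -> invariant_function Y f -> forall x y, f x = f y) ->
  flow_minimal Y.
Proof.
move=> Hc x O [y Oy] oO; apply: contrapT => nO.
have clO : closed (~` O) by exact: open_closedC.
have us : uniform_separator [set y] (~` O).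
  by apply: point_uniform_separator => //; exact.
have [f [cf _ fy fO]] := (@uniform_separatorP _ R _ _).1 us.
pose f1 z := 1 - f z.
have cf1 : continuous f1.
  by move=> z; apply: (@continuousB R R L); [exact: cst_continuous|exact: cf].
have [B _ fB] := continuous_bounded (flow_compact Y) cf1.
have fB' z : f1 z <= B by apply: le_trans (fB z); exact: ler_norm.
have := Hc _ (orbit_sup_continuous cf1) (@orbit_sup_invariant f1) x y.
have -> : orbit_sup f1 x = 0.
  rewrite /orbit_sup (_ : range (fun g => f1 (Y g x)) = [set 0]) ?sup1//.
  apply/seteqP; split=> [_ [g _ <-]|_ ->].
    rewrite /f1 /=; apply/eqP; rewrite subr_eq0 eq_sym; apply/eqP.
    apply: fO; exists (Y g x) => //= Og; apply: nO; by exists (Y g x).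
  exists 0 => //; rewrite /f1; apply/eqP; rewrite subr_eq0 eq_sym; apply/eqP.
  apply: fO; exists (Y 0 x) => //= Og; apply: nO; by exists (Y 0 x).
have := @range_sup_ge R G (fun g => f1 (Y g y)) B 0 (fun g => fB' _).
rewrite act0 -/(orbit_sup f1 y) /f1 (fy (f y)); last by exists y.
by rewrite subr0 => h e; rewrite -e ler10 in h.
Qed.

Section InvariantMetric.
Variable f : L -> R.
Hypotheses (cf : continuous f) (f01 : forall x, 0 <= f x <= 1).

(** An invariant continuous pseudometric separating the points that f separates.
    It is used below as the kernel of an integral operator. *)
Definition orbit_dist x y := sup (range (fun g => `|f (Y g x) - f (Y g y)|)).

Let bnd x y : `|f x - f y| <= 1.
Proof.
by rewrite ler_norml; have /andP[? ?] := f01 x; have /andP[? ?] := f01 y; apply/andP; split; lra.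
Qed.

Lemma orbit_dist_ge g x y : `|f (Y g x) - f (Y g y)| <= orbit_dist x y.
Proof. exact: (@range_sup_ge R G (fun g => `|f (Y g x) - f (Y g y)|) 1). Qed.

Lemma orbit_dist_ge0 x y : 0 <= orbit_dist x y.
Proof. exact: le_trans (orbit_dist_ge 0 x y). Qed.

Lemma orbit_dist_le1 x y : orbit_dist x y <= 1.
Proof. exact: (@range_sup_le R G 0). Qed.

Lemma orbit_dist_inv g x y : orbit_dist (Y g x) (Y g y) = orbit_dist x y.
Proof.
rewrite /orbit_dist; congr sup.
rewrite -(range_translate (fun g => `|f (Y g x) - f (Y g y)|) g).
by apply: eq_range => h; rewrite !flow_actA.
Qed.

Lemma orbit_dist_sym x y : orbit_dist x y = orbit_dist y x.
Proof. by congr sup; apply: eq_range => g; rewrite distrC. Qed.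

Lemma orbit_dist_xx x : orbit_dist x x = 0.
Proof.
apply/eqP; rewrite eq_le orbit_dist_ge0 andbT.
by apply: (@range_sup_le R G 0) => g; rewrite subrr normr0.
Qed.

Lemma orbit_dist_lip x y z : `|orbit_dist x z - orbit_dist y z| <= orbit_dist x y.
Proof.
apply: (@sup_dist_le R _ 0 _ _ 1) => // g.
apply: le_trans (ler_dist_dist _ _) _; rewrite (_ : _ - _ - _ = f (Y g x) - f (Y g y)).
  exact: orbit_dist_ge.
by ring.
Qed.

Lemma orbit_dist_small e : 0 < e -> exists2 D : set (L * L), entourage D &
  forall x y, D (x, y) -> orbit_dist x y <= e.
Proof.
move=> e0; have [D entD Df] := orbit_sup_equi cf e0; exists D => // x y Dxy.
by apply: (@range_sup_le R G 0) => g; exact: Df.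
Qed.

End InvariantMetric.
End Equi.

(** * The invariant mean of a minimal equicontinuous flow *)
Section ContinuousReal.
Variables (R : realType) (T : topologicalType).
Implicit Types f g : T -> R.

Lemma ctsD f g : continuous f -> continuous g -> continuous (fun x => f x + g x).
Proof. by move=> cf cg x; apply: (@continuousD R R T); [exact: cf|exact: cg]. Qed.

Lemma ctsN f : continuous f -> continuous (fun x => - f x).
Proof. by move=> cf x; apply: (@continuousN R R T); exact: cf. Qed.

Lemma ctsB f g : continuous f -> continuous g -> continuous (fun x => f x - g x).
Proof. by move=> cf cg x; apply: (@continuousB R R T); [exact: cf|exact: cg]. Qed.

Lemma ctsM f g : continuous f -> continuous g -> continuous (fun x => f x * g x).
Proof. by move=> cf cg x; apply: (@continuousM R T); [exact: cf|exact: cg]. Qed.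

Lemma cts_cst (c : R) : continuous (fun _ : T => c).
Proof. exact: cst_continuous. Qed.

Lemma ctsZ c f : continuous f -> continuous (fun x => c * f x).
Proof. by apply: ctsM; exact: cts_cst. Qed.

Lemma cts_sum I (r : seq I) (F : I -> T -> R) : (forall i, continuous (F i)) ->
  continuous (fun x => \sum_(i <- r) F i x).
Proof.
by move=> cF; apply: continuous_big => [|i _]; [exact: add_continuous|exact: cF].
Qed.

End ContinuousReal.

Lemma sum_seq_le (R : realType) (I : Type) (s : seq I) (F : I -> R) M :
  (forall i, F i <= M) -> \sum_(i <- s) F i <= (size s)%:R * M.
Proof.
move=> FM; elim: s => [|i s IH]; first by rewrite big_nil mul0r.
by rewrite big_cons /= -natr1 mulrDl mul1r addrC lerD.
Qed.

Section Mean.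
Variables (R : realType) (G : topologicalZmodType) (L : uniformType) (Y : flow G L).
Hypotheses (Yeq : equicontinuous_flow Y) (Ymin : flow_minimal Y).
Variable x0 : L.
Implicit Types (f : L -> R) (A B : seq G).

Lemma cts_translate f g : continuous f -> continuous (fun x => f (Y g x)).
Proof.
by move=> cf x; apply: continuous_comp; [exact: flow_act_continuous|exact: cf].
Qed.

(** Every orbit being dense, some translate of y is D-close to x; compactness of
    L x L makes finitely many group elements enough for all pairs at once. *)
Lemma syndetic (D : set (L * L)) : entourage D ->
  exists s : seq G, forall x y, exists2 g, g \in s & D (x, Y g y).
Proof.
move=> entD.
have /compact_near_coveringP cLL := compact_setX (flow_compact Y) (flow_compact Y).
pose F : set_system (seq G) :=
  filter_from [set: seq G] (fun s : seq G => [set s' : seq G | forall g, g \in s -> g \in s']).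
have FF : Filter F.
  apply: filter_from_filter; first by exists [::].
  move=> s t _ _; exists (s ++ t) => // u stu.
  by split=> g gi; apply: stu; rewrite mem_cat gi ?orbT.
have := cLL _ F (fun (s : seq G) p => exists2 g, g \in s & D (p.1, Y g p.2)) FF.
move=> H; case: H => [[x y] _|s _ sP]; last first.
  by exists s => x y; exact: (sP s (fun _ => id) (x, y)).
pose E := split_ent D; have entE : entourage E := entourage_split_ent entD.
pose E' := split_ent E; have entE' : entourage E' := entourage_split_ent entE.
have : nbhs x (xsection E' x) by exact: nbhs_entourage.
rewrite nbhsE; case=> O [oO Ox] OE.
have [z [Og [g _ gz]]] := Ymin y (ex_intro O x Ox) oO.
rewrite -gz in Og.
exists (xsection (E'^-1)%relation x `*` ((Y g) @^-1` xsection E (Y g y)),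
        [set s : seq G | g \in s]).
  split; last by exists [:: g] => // s; apply; rewrite inE.
  exists (xsection (E'^-1)%relation x, (Y g) @^-1` xsection E (Y g y)) => //=.
  split; first by apply: nbhs_entourage; exact: entourage_inv.
  by apply: flow_act_continuous; exact: nbhs_entourage.
move=> [[x' y'] s] /= [[/xsectionP x'x /xsectionP yy'] gs]; exists g => //.
apply: (entourage_split (Y g y)) => //.
apply: (entourage_split x) => //.
by have /xsectionP := OE _ Og.
Qed.

Definition avg A f x := (size A)%:R^-1 * \sum_(g <- A) f (Y g x).

Lemma avg_continuous A f : continuous f -> continuous (avg A f).
Proof. by move=> cf; apply: ctsZ; apply: cts_sum => g; exact: cts_translate. Qed.

Lemma size_neq0 (A : seq G) : A <> [::] -> (size A)%:R != 0 :> R.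
Proof. by case: A => // g A _; rewrite pnatr_eq0. Qed.

Lemma avg_cst A c x : A <> [::] -> avg A (fun _ => c) x = c.
Proof.
move=> A0; rewrite /avg big_const_seq count_predT iter_addr addr0 -[c *+ _]mulr_natl.
by rewrite mulrA mulVf ?size_neq0// mul1r.
Qed.

Lemma avg_le A f f' x : (forall x, f x <= f' x) -> avg A f x <= avg A f' x.
Proof. by move=> ff'; rewrite ler_wpM2l ?invr_ge0// ler_sum. Qed.

Lemma avg_close A f f' e x : A <> [::] -> (forall x, `|f x - f' x| <= e) ->
  `|avg A f x - avg A f' x| <= e.
Proof.
move=> A0 ff'; have ffe u : f u <= f' u + e by have := ff' u; rewrite ler_distlC => /andP[]; lra.
have ffe' u : f' u - e <= f u by have := ff' u; rewrite ler_distlC => /andP[]; lra.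
have aD c : avg A (fun u => f' u + c) x = avg A f' x + c.
  by rewrite -[in RHS](avg_cst c x A0) /avg -mulrDr -big_split.
rewrite ler_distl -aD -aD; apply/andP; split; exact: avg_le.
Qed.

Lemma avg_comp A B f : avg A (avg B f) = avg [seq g + h | g <- A, h <- B] f.
Proof.
apply/funext => x; rewrite /avg -mulr_sumr mulrA -invfM -natrM size_allpairs.
congr (_ * _); rewrite big_allpairs_dep; apply: eq_bigr => g _.
by apply: eq_bigr => h _; rewrite flow_actA addrC.
Qed.

Lemma allpairs_neq0 A B : A <> [::] -> B <> [::] -> [seq g + h | g <- A, h <- B] <> [::].
Proof. by case: A B => // g A [|h B]. Qed.

(** Averaging operators commute because G is abelian: this makes the mean unique
    and additive. *)
Lemma avgC A B f : avg A (avg B f) = avg B (avg A f).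
Proof.
apply/funext => x; rewrite /avg -!mulr_sumr mulrCA; congr (_ * (_ * _)).
rewrite exchange_big; apply: eq_bigr => h _; apply: eq_bigr => g _.
by rewrite !flow_actA addrC.
Qed.

Lemma avgD A f f' : avg A (fun x => f x + f' x) = (fun x => avg A f x + avg A f' x).
Proof. by apply/funext => x; rewrite /avg big_split /= mulrDr. Qed.

Definition is_mean f c := forall e, 0 < e ->
  exists2 A, A <> [::] & forall x, `|avg A f x - c| <= e.

Lemma avg_near A f c e : A <> [::] -> (forall x, `|f x - c| <= e) ->
  forall x, `|avg A f x - c| <= e.
Proof.
by move=> A0 fc x; rewrite -[X in _ - X](avg_cst c x A0); exact: avg_close.
Qed.

Lemma is_mean_unique f c c' : is_mean f c -> is_mean f c' -> c = c'.
Proof.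
move=> fc fc'; apply/eqP; rewrite -subr_eq0 -normr_le0; apply/ler_addgt0Pr => e e0.
have e2 : 0 < e / 2 by rewrite divr_gt0.
have [A A0 Af] := fc _ e2; have [B B0 Bf] := fc' _ e2.
have h1 := avg_near B0 Af x0; have h2 := avg_near A0 Bf x0.
rewrite avgC in h2; rewrite distrC in h1.
rewrite (_ : c - c' = (c - avg B (avg A f) x0) + (avg B (avg A f) x0 - c')); last by ring.
by apply: le_trans (ler_normD _ _) _; lra.
Qed.

(** Let c be the infimum of the upper bounds of averages of f. An average
    bounded by c + d with d small cannot dip far below c at any point: every
    orbit would visit the dip at some element of a fixed finite set, so
    averaging it once more over that set would give an upper bound smaller than
    c. *)
Lemma mean_exists f : continuous f -> exists c, is_mean f c.
Proof.
move=> cf; have [B B0 fB] := continuous_bounded (flow_compact Y) cf.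
pose S := [set s | exists2 A, A <> [::] & forall x, avg A f x <= s].
have Slb : has_lbound S.
  exists (- B) => s [A A0 As]; apply: le_trans (As x0).
  rewrite -(avg_cst (- B) x0 A0); apply: avg_le => x.
  by have := fB x; rewrite ler_norml => /andP[].
have Sinf : has_inf S.
  split => //; exists B, [:: 0] => // x.
  rewrite /avg big_seq1 /= invr1 mul1r; apply: le_trans (fB _); exact: ler_norm.
exists (inf S) => e e0; set c := inf S.
have e2 : 0 < e / 2 by rewrite divr_gt0.
have [D entD Df] := orbit_sup_equi Yeq cf e2.
have [s sP] := syndetic entD.
have s0 : (0 < size s)%N by have [g] := sP x0 x0; case: (s).
pose k : R := (size s)%:R; have k0 : 0 < k by rewrite ltr0n.
(* With this d, one value below c - e / 2 out of k outweighs the excess d of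
   the other k - 1 values. *)
pose d := e / 2 / k; have d0 : 0 < d by rewrite divr_gt0.
have [s1 [A A0 As1] /ltW cd] := inf_adherent d0 Sinf.
have Ac x : avg A f x <= c + d by exact: le_trans (As1 x) cd.
exists A => // x; rewrite ler_distl; apply/andP; split; last first.
  apply: le_trans (Ac x) _; rewrite lerD2l /d ler_pdivrMr//.
  have k1 : 1 <= k by rewrite ler1n.
  nra.
rewrite leNgt; apply/negP => hx.
have h_mod u v : D (u, v) -> `|avg A f u - avg A f v| <= e / 2.
  move=> Duv; rewrite /avg -mulrBr -sumrB normrM ger0_norm ?invr_ge0//.
  rewrite ler_pdivrMl ?ltr0n; last by case: (A) A0.
  apply: le_trans (ler_norm_sum _ _ _) _.
  by apply: sum_seq_le => g; exact: Df.
have : S (c - d / k).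
  exists [seq g + h | g <- s, h <- A].
    by apply: allpairs_neq0 => //; case: (s) s0.
  move=> y; rewrite -avg_comp {1}/avg.
  have [g gs Dg] := sP x y.
  rewrite -/k ler_pdivrMl// (big_rem g gs) /=.
  have hg : avg A f (Y g y) <= c - e / 2.
    by have := h_mod _ _ Dg; rewrite ler_distlC => /andP[_]; lra.
  have := @sum_seq_le R _ (rem g s) (fun g => avg A f (Y g y)) (c + d) (fun _ => Ac _).
  rewrite size_rem// (_ : (size s).-1%:R = k - 1); last first.
    by rewrite /k -[in RHS](prednK s0) -natr1 addrK.
  move=> hr.
  have kd : k * d = e / 2 by rewrite /d mulrC divfK// gt_eqF.
  have kdk : k * (d / k) = d by rewrite mulrC divfK// gt_eqF.
  have -> : k * (c - d / k) = k * c - d by rewrite mulrBr kdk.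
  by move: hr; rewrite mulrBl mulrDr kd mul1r; lra.
move=> /(ge_inf Slb); rewrite -/c; have : 0 < d / k by rewrite divr_gt0.
lra.
Qed.

Definition mean f : R := xget 0 [set c | is_mean f c].

Lemma meanP f : continuous f -> is_mean f (mean f).
Proof. by move=> /mean_exists[c fc]; exact: (@xgetPex _ 0 [set c | is_mean f c]) (ex_intro _ c fc). Qed.

Lemma mean_eq f c : is_mean f c -> mean f = c.
Proof.
move=> fc; apply: is_mean_unique (fc).
exact: (@xgetPex _ 0 [set c | is_mean f c]) (ex_intro _ c fc).
Qed.

Lemma mean_cst c : mean (fun _ => c) = c.
Proof.
apply: mean_eq => e e0; exists [:: 0] => // x.
by rewrite avg_cst// subrr normr0 ltW.
Qed.

Lemma meanZ c f : continuous f -> mean (fun x => c * f x) = c * mean f.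
Proof.
move=> cf; apply: mean_eq => e e0.
have c1 : 0 < `|c| + 1 by rewrite ltr_wpDl.
have [A A0 Af] := meanP cf (divr_gt0 e0 c1).
exists A => // x; rewrite {1}/avg -mulr_sumr mulrCA -/(avg A f x) -mulrBr normrM.
apply: le_trans (ler_wpM2l (normr_ge0 _) (Af x)) _.
by rewrite mulrCA ger_pMr// ler_pdivrMr// mul1r lerDl.
Qed.

Lemma meanD f f' : continuous f -> continuous f' ->
  mean (fun x => f x + f' x) = mean f + mean f'.
Proof.
move=> cf cf'; apply: mean_eq => e e0; have e2 : 0 < e / 2 by rewrite divr_gt0.
have [A A0 Af] := meanP cf e2; have [B B0 Bf] := meanP cf' e2.
exists [seq g + h | g <- A, h <- B]; first exact: allpairs_neq0.
move=> x; rewrite -avg_comp.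
have -> : avg A (avg B (fun x => f x + f' x)) x = avg B (avg A f) x + avg A (avg B f') x.
  by rewrite (avgD B) (avgD A) (avgC A B f).
have h1 := avg_near B0 Af x; have h2 := avg_near A0 Bf x.
rewrite opprD addrACA; apply: le_trans (ler_normD _ _) _; lra.
Qed.

Lemma meanN f : continuous f -> mean (fun x => - f x) = - mean f.
Proof.
by move=> cf; rewrite -mulN1r -meanZ//; congr mean; apply/funext => x; rewrite mulN1r.
Qed.

Lemma meanB f f' : continuous f -> continuous f' ->
  mean (fun x => f x - f' x) = mean f - mean f'.
Proof. by move=> cf cf'; rewrite meanD ?meanN//; exact: ctsN. Qed.

Lemma mean_sum I (r : seq I) (F : I -> L -> R) : (forall i, continuous (F i)) ->
  mean (fun x => \sum_(i <- r) F i x) = \sum_(i <- r) mean (F i).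
Proof.
move=> cF; elim: r => [|i r IH].
  by rewrite big_nil -[RHS](mean_cst 0); congr mean; apply/funext => x; rewrite big_nil.
rewrite big_cons -IH -meanD//; last exact: cts_sum.
by congr mean; apply/funext => x; rewrite big_cons.
Qed.

Lemma mean_inv g f : continuous f -> mean (fun x => f (Y g x)) = mean f.
Proof.
move=> cf; apply: mean_eq => e /(meanP cf)[A A0 Af]; exists A => // x.
rewrite (_ : avg A _ x = avg A f (Y g x))//; congr (_ * _).
by apply: eq_bigr => h _; rewrite !flow_actA addrC.
Qed.

Lemma mean_ge0 f : continuous f -> (forall x, 0 <= f x) -> 0 <= mean f.
Proof.
move=> cf f0; apply/ler_addgt0Pr => e e0; have [A A0 Af] := meanP cf e0.
have : 0 <= avg A f x0 by rewrite -(avg_cst 0 x0 A0) avg_le.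
by have := Af x0; rewrite ler_distlC => /andP[]; lra.
Qed.

Lemma mean_le f f' : continuous f -> continuous f' -> (forall x, f x <= f' x) ->
  mean f <= mean f'.
Proof.
move=> cf cf' ff'; rewrite -subr_ge0 -meanB//; apply: mean_ge0; first exact: ctsB.
by move=> x; rewrite subr_ge0.
Qed.

Lemma mean_dist f f' e : continuous f -> continuous f' ->
  (forall x, `|f x - f' x| <= e) -> `|mean f - mean f'| <= e.
Proof.
move=> cf cf' ff'; rewrite -meanB//; have c := ctsB cf cf'.
rewrite ler_norml; apply/andP; split.
  rewrite -[leLHS]mean_cst; apply: mean_le => // [|x]; first exact: cts_cst.
  by have := ff' x; rewrite ler_norml => /andP[].
rewrite -[leRHS]mean_cst; apply: mean_le => // [|x]; first exact: cts_cst.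
by have := ff' x; rewrite ler_norml => /andP[].
Qed.

(** The mean is faithful: if f is positive somewhere, finitely many translates
    of f have a sum bounded below by a positive constant. *)
Lemma mean_eq0 f : continuous f -> (forall x, 0 <= f x) -> mean f = 0 ->
  forall x, f x = 0.
Proof.
move=> cf f0 m0 x; apply/eqP; rewrite eq_le f0 andbT leNgt; apply/negP => fx.
have f2 : 0 < f x / 2 by rewrite divr_gt0.
have [D entD Df] := continuous_has_modulus (flow_compact Y) cf f2.
have [s sP] := syndetic entD.
have s0 : (0 < size s)%N by have [g] := sP x0 x0; case: (s).
have k0 : 0 < (size s)%:R :> R by rewrite ltr0n.
suff : f x / 2 / (size s)%:R <= mean (avg s f).
  rewrite /avg meanZ; last by apply: cts_sum => g; exact: cts_translate.
  rewrite mean_sum; last by move=> g; exact: cts_translate.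
  rewrite big1; last by move=> g _; rewrite mean_inv.
  by rewrite mulr0 leNgt divr_gt0.
rewrite -[leLHS]mean_cst; apply: mean_le; [exact: cts_cst|exact: avg_continuous|].
move=> y; rewrite /avg [leLHS]mulrC ler_wpM2l ?invr_ge0//.
have [g gs /Df] := sP x y; rewrite ler_distlC => /andP[h _].
rewrite (big_rem g gs) /=.
have : 0 <= \sum_(h <- rem g s) f (Y h y) by exact: sumr_ge0.
lra.
Qed.

(** A single average computes the inner means of F x for all x up to e, by
    compactness; and averages commute with the mean in x. *)
Lemma mean_fubini (F : L -> L -> R) :
  (forall e, 0 < e -> exists2 D : set (L * L), entourage D &
     forall x x' y, D (x, x') -> `|F x y - F x' y| <= e) ->
  (forall x, continuous (F x)) ->
  mean (fun x => mean (F x)) = mean (fun y => mean (F^~ y)).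
Proof.
move=> F1 F2.
have cF1 y : continuous (F^~ y).
  apply: has_modulus_continuous => e /F1[D entD Df].
  by exists D => // x x'; exact: Df.
have cm : continuous (fun x => mean (F x)).
  apply: has_modulus_continuous => e /F1[D entD Df].
  by exists D => // x x' Dxx'; apply: mean_dist => // y; exact: Df.
symmetry; apply: mean_eq => e e0.
have e3 : 0 < e / 3 by rewrite divr_gt0.
have [D entD Df] := F1 _ e3.
have [s sP] := syndetic entD.
have common (xs : seq L) : exists2 A, A <> [::] &
    forall x y, x \in xs -> `|avg A (F x) y - mean (F x)| <= e / 3.
  elim: xs => [|x xs [A A0 Axs]]; first by exists [:: 0].
  have [B B0 Bx] := meanP (F2 x) e3.
  exists [seq g + h | g <- A, h <- B]; first exact: allpairs_neq0.
  move=> u y; rewrite inE -avg_comp => /orP[/eqP ->|uxs].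
    exact: avg_near.
  by rewrite avgC; apply: avg_near => // z; exact: Axs.
have [A A0 Axs] := common [seq Y g x0 | g <- s].
exists A => // y.
have -> : avg A (fun y => mean (F^~ y)) y = mean (fun x => avg A (F x) y).
  rewrite /avg meanZ; last by apply: cts_sum => g; exact: cF1.
  by rewrite mean_sum// => g; exact: cF1.
apply: mean_dist => //.
  by apply: ctsZ; apply: cts_sum => g; exact: cF1.
move=> x; have [g gs Dxg] := sP x x0.
have h1 := Axs (Y g x0) y (map_f _ gs).
have h2 : `|avg A (F x) y - avg A (F (Y g x0)) y| <= e / 3.
  by apply: avg_close => // z; exact: Df.
have h3 : `|mean (F x) - mean (F (Y g x0))| <= e / 3.
  by apply: mean_dist => // z; exact: Df.
rewrite distrC in h3.
rewrite (_ : _ - _ = (avg A (F x) y - avg A (F (Y g x0)) y) +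
  (avg A (F (Y g x0)) y - mean (F (Y g x0))) + (mean (F (Y g x0)) - mean (F x)));
  last by ring.
apply: le_trans (ler_normD _ _) _.
have := ler_normD (avg A (F x) y - avg A (F (Y g x0)) y)
  (avg A (F (Y g x0)) y - mean (F (Y g x0))).
lra.
Qed.

End Mean.

(** * Common eigenvectors of commuting matrices *)
(** Take a nonzero stable subspace of least dimension. Each member of the family
    has an eigenvector in it, and the corresponding eigenspace meets it in a
    stable subspace, so the eigenspace contains it. *)
Lemma commuting_family_eigenvector (C : numClosedFieldType) (I : Type) n (A : I -> 'M[C]_n) :
  (0 < n)%N -> (forall i j, A i *m A j = A j *m A i) ->
  exists2 v : 'rV[C]_n, v != 0 & forall i, exists a, v *m A i = a *: v.
Proof.
move=> n0 Acomm.
pose P k := `[< exists V : 'M[C]_n, \rank V = k.+1 /\ forall i, stablemx V (A i) >].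
have exP : exists k, P k.
  exists n.-1; apply/asboolP; exists 1%:M; rewrite mxrank1 prednK//; split=> // i.
  by rewrite mul1mx submx1.
have [k /asboolP[V [rV sV]] kmin] := ex_minnP exP.
have V0 : V != 0 by rewrite -mxrank_eq0 rV.
suff VE i : exists a, (V <= eigenspace (A i) a)%MS.
  exists (nz_row V); first by rewrite nz_row_eq0.
  move=> i; have [a Va] := VE i; exists a.
  by apply/eigenspaceP; apply: submx_trans (nz_row_sub V) Va.
have /submxP[B BE] : stablemx (row_base V) (A i) by rewrite stablemx_row_base.
have [|a /eigenvalueP[w wB w0]] := eigenvalue_closed B; first by rewrite rV.
exists a; pose v := w *m row_base V.
have v0 : v != 0 by rewrite mulmx_free_eq0 ?row_base_free.
have vA : v *m A i = a *: v by rewrite -mulmxA BE mulmxA wB scalemxAl.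
pose U := (V :&: eigenspace (A i) a)%MS.
have vU : (v <= U)%MS.
  rewrite sub_capmx; apply/andP; split; last exact/eigenspaceP.
  by rewrite -(eq_row_base V) submxMl.
have sU j : stablemx U (A j).
  rewrite sub_capmx; apply/andP; split.
    by apply: submx_trans (sV j); apply: submxMr; exact: capmxSl.
  apply: submx_trans (comm_mx_stable_eigenspace a (Acomm i j)).
  by apply: submxMr; exact: capmxSr.
have rU : (0 < \rank U)%N.
  by rewrite lt0n mxrank_eq0; apply/eqP => U0; move: vU; rewrite U0 submx0 (negbTE v0).
have UV : (U <= V)%MS by exact: capmxSl.
have : (k <= (\rank U).-1)%N.
  by apply: kmin; apply/asboolP; exists U; rewrite prednK.
rewrite -ltnS prednK// -rV => rVU.
have : (V <= U)%MS by rewrite -(geq_leqif (mxrank_leqif_sup UV)).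
by move=> /submx_trans; apply; exact: capmxSr.
Qed.

(** * Kernel operators commuting with the flow *)
Lemma discriminant_le (R : realType) (a b c : R) :
  (forall t, 0 <= a + 2 * t * b + t ^+ 2 * c) -> 0 <= c -> b ^+ 2 <= a * c.
Proof.
move=> H; rewrite le_eqVlt => /orP[/eqP c0|c0].
  rewrite -c0 mulr0; have [->|b0] := eqVneq b 0; first by rewrite expr0n.
  have := H (- (a + 1) / (2 * b)).
  have -> : 2 * (- (a + 1) / (2 * b)) * b = - (a + 1) by field.
  by rewrite -c0 mulr0 addr0; lra.
have := H (- b / c).
have -> : a + 2 * (- b / c) * b + (- b / c) ^+ 2 * c = a - b ^+ 2 / c.
  by field; rewrite gt_eqF.
by rewrite subr_ge0 ler_pdivrMr.
Qed.

Section Spectral.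
Variables (R : realType) (G : topologicalZmodType) (L : uniformType) (Y : flow G L).
Hypotheses (Yeq : equicontinuous_flow Y) (Ymin : flow_minimal Y).
Variable x0 : L.
Implicit Types f h u w : L -> R.

(** The inner product of the space L^2 for the invariant mean. *)
Definition ip f h : R := mean Y (fun x => f x * h x).

Lemma ipC f h : ip f h = ip h f.
Proof. by congr mean; apply/funext => x; rewrite mulrC. Qed.

Lemma ipDl f f' h : continuous f -> continuous f' -> continuous h ->
  ip (fun x => f x + f' x) h = ip f h + ip f' h.
Proof.
move=> cf cf' ch; rewrite /ip -meanD//; try exact: ctsM.
by congr mean; apply/funext => x; rewrite mulrDl.
Qed.

Lemma ipZl c f h : continuous f -> continuous h ->
  ip (fun x => c * f x) h = c * ip f h.
Proof.
move=> cf ch; rewrite /ip -meanZ//; last exact: ctsM.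
by congr mean; apply/funext => x; rewrite mulrA.
Qed.

Lemma ipDr f h h' : continuous f -> continuous h -> continuous h' ->
  ip f (fun x => h x + h' x) = ip f h + ip f h'.
Proof. by move=> *; rewrite ipC ipDl// !(ipC f). Qed.

Lemma ipZr c f h : continuous f -> continuous h ->
  ip f (fun x => c * h x) = c * ip f h.
Proof. by move=> *; rewrite ipC ipZl// (ipC f). Qed.

Lemma ip_ge0 f : continuous f -> 0 <= ip f f.
Proof. by move=> cf; apply: mean_ge0 => // [|x]; [exact: ctsM|exact: sqr_ge0]. Qed.

Lemma ip_eq0 f : continuous f -> ip f f = 0 -> forall x, f x = 0.
Proof.
move=> cf f0 x; apply/eqP; rewrite -sqrf_eq0; apply/eqP.
apply: (@mean_eq0 R G L Y Yeq Ymin x0 (fun x => f x ^+ 2)) => [|{}x|]; last exact: f0.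
  exact: ctsM.
exact: sqr_ge0.
Qed.

Lemma ip_expand u w t : continuous u -> continuous w ->
  ip (fun x => u x + t * w x) (fun x => u x + t * w x)
  = ip u u + 2 * t * ip u w + t ^+ 2 * ip w w.
Proof.
move=> cu cw; have cz := @ctsZ R L t w cw; have cs := ctsD cu cz.
by rewrite ipDl// !ipDr// !ipZl// !ipZr// (ipC w u); ring.
Qed.

Lemma ip_CS f h : continuous f -> continuous h -> ip f h ^+ 2 <= ip f f * ip h h.
Proof.
move=> cf ch; apply: discriminant_le; last exact: ip_ge0.
by move=> t; rewrite -ip_expand//; apply: ip_ge0; apply: ctsD => //; exact: ctsZ.
Qed.

Lemma ip_bound f h c : continuous f -> continuous h -> 0 <= c ->
  (forall x, `|h x| <= c) -> ip f f <= 1 -> `|ip h f| <= c.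
Proof.
move=> cf ch c0 hc f1.
have hh : ip h h <= c ^+ 2.
  rewrite -[leRHS](mean_cst Y x0); apply: mean_le => // [||x].
  - exact: ctsM.
  - exact: cts_cst.
  - by rewrite -expr2 -real_normK ?num_real// ler_pXn2r ?nnegrE.
rewrite -(@ler_pXn2r _ 2) ?nnegrE// real_normK ?num_real//.
apply: le_trans (ip_CS ch cf) _; apply: le_trans hh.
by rewrite ler_piMr// ip_ge0.
Qed.

Variable d : L -> L -> R.
Hypotheses (d_le1 : forall x y, `|d x y| <= 1) (d_sym : forall x y, d x y = d y x)
  (d_inv : forall g x y, d (Y g x) (Y g y) = d x y)
  (d_lip : forall x y z, `|d x z - d y z| <= d x y)
  (d_small : forall e, 0 < e -> exists2 D : set (L * L), entourage D &
    forall x y, D (x, y) -> d x y <= e).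

Let d_ge0 x y : 0 <= d x y.
Proof. exact: le_trans (d_lip x y x). Qed.

Lemma kernel_continuous x : continuous (d x).
Proof.
apply: has_modulus_continuous => e /d_small[D entD De]; exists D => // y y' Dyy'.
by rewrite !(d_sym x); apply: le_trans (d_lip _ _ _) _; exact: De.
Qed.

Lemma lip_continuous f c : (forall x y, `|f x - f y| <= c * d x y) -> 0 <= c -> continuous f.
Proof.
move=> fd c0; apply: has_modulus_continuous => e e0.
have c1 : 0 < c + 1 by rewrite ltr_wpDl.
have [D entD De] := d_small (divr_gt0 e0 c1).
exists D => // x y /De; rewrite ler_pdivlMr// => h; apply: le_trans (fd x y) _.
by have := d_ge0 x y; nra.
Qed.

Definition kernel_op f x := ip (d x) f.

Lemma kernel_op_continuous f : continuous f -> continuous (kernel_op f).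
Proof.
move=> cf; have [B B0 fB] := continuous_bounded (flow_compact Y) cf.
apply: (@lip_continuous _ B); last exact: ltW.
move=> x y; apply: mean_dist => // [||z]; try (apply: ctsM => //; exact: kernel_continuous).
rewrite -mulrBl normrM mulrC; apply: ler_pM => //.
Qed.

Lemma kernel_opD f h : continuous f -> continuous h ->
  kernel_op (fun x => f x + h x) = fun x => kernel_op f x + kernel_op h x.
Proof. by move=> cf ch; apply/funext => x; rewrite /kernel_op ipDr//; exact: kernel_continuous. Qed.

Lemma kernel_opZ c f : continuous f -> kernel_op (fun x => c * f x) = fun x => c * kernel_op f x.
Proof. by move=> cf; apply/funext => x; rewrite /kernel_op ipZr//; exact: kernel_continuous. Qed.

(** The operator commutes with translations because the kernel and the mean are
    invariant. *)
Lemma kernel_op_translate g f : continuous f -> kernel_op (fun x => f (Y g x)) = fun x => kernel_op f (Y g x).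
Proof.
move=> cf; apply/funext => x; rewrite /kernel_op /ip.
rewrite -(@mean_inv R G L Y Yeq Ymin x0 g (fun y => d (Y g x) y * f y)); last first.
  by apply: ctsM => //; exact: kernel_continuous.
by congr mean; apply/funext => y; rewrite d_inv.
Qed.

Lemma kernel_op_dist f h e : continuous f -> continuous h -> 0 <= e ->
  (forall x, `|f x - h x| <= e) -> forall x, `|kernel_op f x - kernel_op h x| <= e.
Proof.
move=> cf ch e0 fh x; apply: mean_dist => // [||y]; try (apply: ctsM => //; exact: kernel_continuous).
rewrite -mulrBr normrM -[leRHS]mul1r; exact: ler_pM.
Qed.

Lemma kernel_op_selfadjoint f h : continuous f -> continuous h -> ip (kernel_op f) h = ip f (kernel_op h).
Proof.
move=> cf ch.
have [Bf Bf0 fB] := continuous_bounded (flow_compact Y) cf.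
have [B B0 hB] := continuous_bounded (flow_compact Y) ch.
transitivity (mean Y (fun x => mean Y (fun y => d x y * f y * h x))).
  congr mean; apply/funext => x; rewrite mulrC -meanZ//.
    by congr mean; apply/funext => y; rewrite mulrC.
  by apply: ctsM => //; exact: kernel_continuous.
rewrite (@mean_fubini R G L Y Yeq Ymin x0 (fun x y => d x y * f y * h x)).
- congr mean; apply/funext => y; rewrite -meanZ//; last first.
    by apply: ctsM => //; exact: kernel_continuous.
  by congr mean; apply/funext => x; rewrite (d_sym x); ring.
- move=> e e0; have e1 : 0 < e / (Bf * B + Bf) / 2 by rewrite !divr_gt0 ?addr_gt0 ?mulr_gt0.
  have [D entD De] := d_small e1.
  have e2 : 0 < e / Bf / 2 by rewrite !divr_gt0.
  have [D' entD' D'h] := continuous_has_modulus (flow_compact Y) ch e2.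
  exists (D `&` D'); first exact: filterI.
  move=> x x' y [/De dxx' /D'h hxx'].
  have -> : d x y * f y * h x - d x' y * f y * h x' =
    f y * ((d x y - d x' y) * h x + d x' y * (h x - h x')) by ring.
  rewrite normrM.
  apply: (@le_trans _ _ (Bf * (e / Bf))); last by rewrite mulrC divfK ?gt_eqF.
  apply: ler_pM => //; apply: le_trans (ler_normD _ _) _; rewrite !normrM [leRHS]splitr.
  apply: lerD.
    apply: (@le_trans _ _ (e / (Bf * B + Bf) / 2 * B)).
      by apply: ler_pM => //; exact: le_trans (d_lip _ _ _) _.
    rewrite mulrAC ler_pM2r ?invr_gt0// mulrAC ler_pdivrMr ?addr_gt0 ?mulr_gt0//.
    rewrite -[e / Bf * _]mulrA mulrDr mulrA mulVf ?gt_eqF// mul1r mulrDr lerDl.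
    by rewrite mulr_ge0 ?ltW.
  by rewrite -[leRHS]mul1r; apply: ler_pM.
- by move=> x; apply: ctsM; [apply: ctsM => //; exact: kernel_continuous|exact: cts_cst].
Qed.

Definition orthonormal r (e : 'I_r -> L -> R) :=
  forall i j, ip (e i) (e j) = (i == j)%:R.

Lemma ip_sumr (I : finType) f (c : I -> R) (e : I -> L -> R) :
  continuous f -> (forall i, continuous (e i)) ->
  ip f (fun x => \sum_i c i * e i x) = \sum_i c i * ip f (e i).
Proof.
move=> cf ce; under [RHS]eq_bigr => i _ do rewrite -ipZr//.
rewrite /ip -(mean_sum Yeq Ymin x0) => [|i]; last by apply: ctsM => //; exact: ctsZ.
by congr mean; apply/funext => x; rewrite mulr_sumr.
Qed.

Lemma ip_lin_orthonormal r (e : 'I_r -> L -> R) (c : 'I_r -> R) k :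
  (forall i, continuous (e i)) -> orthonormal e ->
  ip (e k) (fun x => \sum_i c i * e i x) = c k.
Proof.
move=> ce oe; rewrite ip_sumr// (bigD1 k)//= oe eqxx mulr1 big1 ?addr0// => i ik.
by rewrite oe eq_sym (negbTE ik) mulr0.
Qed.

Lemma bessel r (e : 'I_r -> L -> R) f : (forall i, continuous (e i)) -> orthonormal e ->
  continuous f -> \sum_i ip f (e i) ^+ 2 <= ip f f.
Proof.
move=> ce oe cf; pose c i := ip f (e i); pose p x := \sum_i c i * e i x.
have cp : continuous p by apply: cts_sum => i; exact: ctsZ.
have fp : ip f p = \sum_i c i ^+ 2 by rewrite ip_sumr//; apply: eq_bigr => i _; rewrite expr2.
have pp : ip p p = \sum_i c i ^+ 2.
  rewrite {2}/p ip_sumr//; apply: eq_bigr => i _.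
  by rewrite ipC ip_lin_orthonormal// expr2.
have := ip_ge0 (ctsD cf (@ctsZ _ _ (-1) _ cp)).
rewrite ip_expand// fp pp -/c; lra.
Qed.

Lemma kernel_op_unit_le f x : continuous f -> ip f f <= 1 -> `|kernel_op f x| <= 1.
Proof. by move=> cf f1; apply: ip_bound => //; exact: kernel_continuous. Qed.

(** The image of the L^2 unit ball is bounded and has a common modulus of
    continuity: this is the compactness of the operator. *)
Lemma kernel_op_unit_lip f x y : continuous f -> ip f f <= 1 ->
  `|kernel_op f x - kernel_op f y| <= d x y.
Proof.
move=> cf f1; have ck := kernel_continuous.
have -> : kernel_op f x - kernel_op f y = ip (fun z => d x z + (-1) * d y z) f.
  by rewrite ipDl// ?ipZl// ?mulN1r//; exact: ctsZ.
apply: ip_bound => //; first by apply: ctsD => //; exact: ctsZ.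
by move=> z; rewrite mulN1r.
Qed.

(** An invariant uniformly closed space W of continuous functions on which the
    operator does not vanish contains an eigenvector of the square of the
    operator, and then, after complexification, an eigenfunction of the flow. *)
Section InvariantSubspace.
Variable W : (L -> R) -> Prop.
Hypotheses (Wcts : forall f, W f -> continuous f)
  (WD : forall f h, W f -> W h -> W (fun x => f x + h x))
  (WZ : forall c f, W f -> W (fun x => c * f x))
  (WY : forall g f, W f -> W (fun x => f (Y g x)))
  (Wop : forall f, W f -> W (kernel_op f))
  (Wlim : forall u, (forall e, 0 < e -> exists2 f, W f & forall x, `|f x - u x| <= e) -> W u).
Variables (w0 : L -> R) (x1 : L).
Hypotheses (Ww0 : W w0) (w0_neq0 : kernel_op w0 x1 != 0).

(** The values of the squared norm of the operator on the unit ball of W; their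
    supremum is the top of the spectrum of the square of the operator on W. *)
Let S := [set s | exists f, [/\ W f, ip f f <= 1 & s = ip (kernel_op f) (kernel_op f)]].

Let lam := sup S.

Let op_norm_le1 f : W f -> ip f f <= 1 -> ip (kernel_op f) (kernel_op f) <= 1.
Proof.
move=> Wf f1; have cf := Wcts Wf; have cP := kernel_op_continuous cf.
rewrite -[leRHS](mean_cst Y x0); apply: mean_le => // [||x].
- exact: ctsM.
- exact: cts_cst.
- rewrite -expr2 -real_normK ?num_real// -(expr1n _ 2) ler_pXn2r ?nnegrE//.
  exact: kernel_op_unit_le.
Qed.

Let S_sup : has_sup S.
Proof.
split.
  exists (ip (kernel_op (fun x => 0 * w0 x)) (kernel_op (fun x => 0 * w0 x))).
  have cw := Wcts Ww0; exists (fun x => 0 * w0 x); split => //; first exact: WZ.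
  by rewrite ipZl ?mul0r//; exact: ctsZ.
by exists 1 => _ [f [Wf f1 ->]]; exact: op_norm_le1.
Qed.

Let lam_ub f : W f -> ip f f <= 1 -> ip (kernel_op f) (kernel_op f) <= lam.
Proof. by move=> Wf f1; apply: ub_le_sup; [exact: S_sup.2|exists f]. Qed.

Let op_norm f : W f -> ip (kernel_op f) (kernel_op f) <= lam * ip f f.
Proof.
move=> Wf; have cf := Wcts Wf; have cP := kernel_op_continuous cf.
have [f0|f0] := eqVneq (ip f f) 0.
  have ff := ip_eq0 cf f0.
  have P0 x : kernel_op f x = 0.
    rewrite /kernel_op /ip -[RHS](mean_cst Y x0); congr mean; apply/funext => y.
    by rewrite ff mulr0.
  rewrite f0 mulr0 /ip -[leRHS](mean_cst Y x0) le_eqVlt; apply/orP; left; apply/eqP.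
  by congr mean; apply/funext => y; rewrite P0 mulr0.
have fp : 0 < ip f f by rewrite lt_neqAle eq_sym f0 ip_ge0.
pose c := Num.sqrt (ip f f)^-1.
have c2 : c * c = (ip f f)^-1 by rewrite -expr2 sqr_sqrtr// invr_ge0 ltW.
have := @lam_ub _ (WZ c Wf); rewrite ipZl ?ipZr//; last exact: ctsZ.
rewrite mulrA c2 mulVf// lexx => /(_ isT).
rewrite kernel_opZ// ipZl ?ipZr//; last exact: ctsZ.
by rewrite mulrA c2 ler_pdivrMl// mulrC.
Qed.

Let lam_gt0 : 0 < lam.
Proof.
have cw := Wcts Ww0; have cP := kernel_op_continuous cw.
have P0 : 0 < ip (kernel_op w0) (kernel_op w0).
  rewrite lt_neqAle ip_ge0// andbT eq_sym; apply/eqP => /(ip_eq0 cP) h.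
  by have := w0_neq0; rewrite h eqxx.
rewrite ltNge; apply/negP => l0.
have := op_norm Ww0; have := ip_ge0 cw; nra.
Qed.

(** The images of almost maximal unit vectors lie in a product of compact
    intervals; u is a cluster point for pointwise convergence. *)
Let cluster_point : exists u : L -> R, forall (xs : seq L) e, 0 < e ->
  exists f, [/\ W f, ip f f <= 1, lam - e < ip (kernel_op f) (kernel_op f)
    & forall z, z \in xs -> `|kernel_op f z - u z| < e].
Proof.
have cT := @tychonoff L (fun _ => R) (fun _ => `[-1, 1]%classic)
  (fun _ => @segment_compact R (-1) 1).
pose Se e := [set h : L -> R | exists f,
  [/\ W f, ip f f <= 1, lam - e < ip (kernel_op f) (kernel_op f) & h = kernel_op f]].
pose F : set_system (prod_topology (fun _ : L => R)) := filter_from [set e : R | 0 < e] Se.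
have FP : ProperFilter F.
  apply: filter_from_proper; first apply: filter_from_filter.
  - by exists 1 => /=.
  - move=> e e' /= e0 e'0; exists (Num.min e e'); first by rewrite /= lt_min e0 e'0.
    move=> h [f [Wf f1 fl hE]]; split; exists f; split=> //; apply: le_lt_trans fl.
      by rewrite lerB// ge_min lexx.
    by rewrite lerB// ge_min lexx orbT.
  - move=> e e0; have [_ [f [Wf f1 ->]] fl] := sup_adherent e0 S_sup.
    by exists (kernel_op f), f.
have [u [_ uF]] : [set f : L -> R | forall x, `[-1, 1]%classic (f x)] `&` cluster F !=set0.
  apply: cT; exists 1 => //= h [f [Wf f1 fl ->]] x /=.
  by rewrite in_itv /= -ler_norml; apply: kernel_op_unit_le => //; exact: Wcts.
exists u => xs e e0.
have FN := nbhs_filter (u : prod_topology (fun _ : L => R)).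
have nu : nbhs (u : prod_topology (fun _ : L => R))
    [set h : L -> R | forall z, z \in xs -> `|h z - u z| < e].
  elim: xs => [|z xs IH]; first by apply: filterE => h.
  have nz : nbhs (u : prod_topology (fun _ : L => R)) [set h : L -> R | `|h z - u z| < e].
    have := @proj_continuous L (fun _ => R) z u.
    move=> /(@cvgr_dist_lt _ R _ _ (nbhs_filter (u : prod_topology (fun _ : L => R)))).
    by move=> /(_ e e0); apply: filterS => h /=; rewrite distrC.
  apply: filterS (filterI nz IH) => h [/= hz hxs] y; rewrite inE => /orP[/eqP ->|] //.
  exact: hxs.
have [|h [[f [Wf f1 fl ->]] hu]] := uF (Se e) _ _ nu; first by exists e.
by exists f.
Qed.

(** The common Lipschitz bound passes to u, and turns approximation at the
    points of a finite net into uniform approximation. *)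
Let uniform_limit : exists u : L -> R, forall e, 0 < e ->
  exists f, [/\ W f, ip f f <= 1, lam - e < ip (kernel_op f) (kernel_op f)
    & forall z, `|kernel_op f z - u z| <= e].
Proof.
have [u uP] := cluster_point; exists u => e e0.
have u_lip x y : `|u x - u y| <= d x y.
  apply/ler_addgt0Pr => t t0; have t2 : 0 < t / 2 by rewrite divr_gt0.
  have [f [Wf f1 _ fu]] := uP [:: x; y] _ t2.
  have h1 := fu x; have h2 := fu y; rewrite !inE !eqxx orbT in h1 h2.
  have h3 := kernel_op_unit_lip x y (Wcts Wf) f1.
  have {}h1 := h1 isT; have {}h2 := h2 isT; rewrite distrC in h1.
  rewrite (_ : u x - u y = (u x - kernel_op f x) + (kernel_op f x - kernel_op f y) + (kernel_op f y - u y)); last by ring.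
  apply: le_trans (ler_normD _ _) _.
  by have := ler_normD (u x - kernel_op f x) (kernel_op f x - kernel_op f y); lra.
have e3 : 0 < e / 3 by rewrite divr_gt0.
have [D entD De] := d_small e3.
have [s sP] := syndetic Ymin entD.
have [f [Wf f1 fl fu]] := uP [seq Y g x0 | g <- s] _ e3.
exists f; split => // [|x]; first by apply: le_lt_trans fl; lra.
have [g gs /De dxg] := sP x x0.
have h1 := fu _ (map_f (fun g => Y g x0) gs).
have h2 := kernel_op_unit_lip x (Y g x0) (Wcts Wf) f1.
have h3 := u_lip x (Y g x0); rewrite distrC in h3.
rewrite (_ : kernel_op f x - u x = (kernel_op f x - kernel_op f (Y g x0)) + (kernel_op f (Y g x0) - u (Y g x0)) +
  (u (Y g x0) - u x)); last by ring.
apply: le_trans (ler_normD _ _) _.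
have := ler_normD (kernel_op f x - kernel_op f (Y g x0)) (kernel_op f (Y g x0) - u (Y g x0)); lra.
Qed.

Let ip_close f u e : continuous f -> continuous u -> (forall x, `|f x| <= 1) ->
  0 <= e -> (forall x, `|f x - u x| <= e) -> `|ip f f - ip u u| <= e * (2 + e).
Proof.
move=> cf cu f1 e0 fu; apply: mean_dist => // [||x]; try exact: ctsM.
rewrite (_ : _ - _ = (f x - u x) * (2 * f x - (f x - u x))); last by ring.
rewrite normrM; apply: ler_pM => //.
apply: le_trans (ler_normB _ _) _; apply: lerD => //.
by rewrite normrM ger0_norm// -[leRHS]mulr1 ler_pM2l.
Qed.

(** The limit u attains the supremum lam of the quotient of |op w|^2 by |w|^2 on
    W. The quadratic form lam |w|^2 - |op w|^2 is nonnegative on W and vanishes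
    at u, so u is in its radical, which says that op (op u) = lam u. *)
Lemma kernel_op_eigenvector : exists (l : R) (u : L -> R),
  [/\ 0 < l, W u, exists x, u x != 0 & forall x, kernel_op (kernel_op u) x = l * u x].
Proof.
have [u uP] := uniform_limit.
have Wu : W u.
  by apply: Wlim => e /uP[f [Wf _ _ fu]]; exists (kernel_op f) => //; exact: Wop.
have cu := Wcts Wu; have cPu := kernel_op_continuous cu.
have small_le (a b : R) : (forall e, 0 < e -> e <= 1 -> a <= b + e * 3) -> a <= b.
  move=> H; apply/ler_addgt0Pr => e e0.
  have m0 : 0 < Num.min 1 (e / 3) by rewrite lt_min ltr01 divr_gt0.
  apply: le_trans (H _ m0 _) _; first by rewrite ge_min lexx.
  by rewrite lerD2l -ler_pdivlMr// ge_min lexx orbT.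
have uu_ge : lam <= ip u u.
  apply: small_le => e e0 e1; have e4 : 0 < e / 2 by rewrite divr_gt0.
  have [f [Wf f1 fl fu]] := uP _ e4.
  have := ip_close (kernel_op_continuous (Wcts Wf)) cu
    (fun x => kernel_op_unit_le x (Wcts Wf) f1) (ltW e4) fu.
  by rewrite ler_distl => /andP[_ h]; nra.
have uu_le : ip u u <= lam.
  apply: small_le => e e0 e1.
  have [f [Wf f1 fl fu]] := uP _ e0.
  have := ip_close (kernel_op_continuous (Wcts Wf)) cu
    (fun x => kernel_op_unit_le x (Wcts Wf) f1) (ltW e0) fu.
  rewrite ler_distlC => /andP[_ h]; have := lam_ub Wf f1; nra.
have uuE : ip u u = lam by apply/eqP; rewrite eq_le uu_le.
have Pu_ge : lam * lam <= ip (kernel_op u) (kernel_op u).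
  apply: small_le => e e0 e1; have e4 : 0 < e / 3 by rewrite divr_gt0.
  have l1 : lam <= 1 by apply: ge_sup S_sup.1 _ => _ [f [Wf f1 ->]]; exact: op_norm_le1.
  have [f [Wf f1 fl fu]] := uP _ e4.
  have cf := Wcts Wf; have cPf := kernel_op_continuous cf; have cPPf := kernel_op_continuous cPf.
  have Pf1 := op_norm_le1 Wf f1.
  have cl := ip_close cPPf cPu (fun x => kernel_op_unit_le x cPf Pf1) (ltW e4)
    (kernel_op_dist cPf cu (ltW e4) fu).
  have CS := ip_CS cPPf cf.
  rewrite kernel_op_selfadjoint// in CS.
  move: cl; rewrite ler_distl => /andP[_ cl].
  have p0 := ip_ge0 cPPf; have p1 := ip_ge0 cPf; have p2 := ip_ge0 cf.
  have l0 := lam_gt0.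
  have h : ip (kernel_op f) (kernel_op f) ^+ 2 <= ip (kernel_op (kernel_op f)) (kernel_op (kernel_op f)).
    by apply: le_trans CS _; rewrite ler_piMr.
  move: h cl fl Pf1 p1 p0; set a := ip (kernel_op f) (kernel_op f); set b := ip (kernel_op (kernel_op f)) _.
  move=> h cl fl Pf1 p1 p0; have : lam * lam <= a ^+ 2 + 2 * (e / 3).
    have q1 : 0 <= (e / 3 - (lam - a)) * (lam + a) by apply: mulr_ge0; lra.
    have q2 : 0 <= e / 3 * (2 - (lam + a)) by apply: mulr_ge0; lra.
    nra.
  have q3 : 0 <= e * (1 - e) by apply: mulr_ge0; lra.
  nra.
have key w : W w -> lam * ip u w = ip (kernel_op u) (kernel_op w).
  move=> Ww; have cw := Wcts Ww; have cPw := kernel_op_continuous cw.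
  pose b := lam * ip u w - ip (kernel_op u) (kernel_op w).
  have := @discriminant_le R 0 b (lam * ip w w - ip (kernel_op w) (kernel_op w)) _ _.
  rewrite mul0r => H; apply/eqP; rewrite -subr_eq0 -/b -sqrf_eq0 eq_le sqr_ge0 andbT.
  apply: H => [t|]; last by rewrite subr_ge0; exact: op_norm.
  have := op_norm (WD Wu (WZ t Ww)).
  rewrite kernel_opD ?kernel_opZ//; last exact: ctsZ.
  rewrite !ip_expand// uuE -subr_ge0 /b; nra.
exists lam, u; split => //.
  apply: contrapT => u0; have u00 x : u x = 0.
    by apply/eqP; apply: contrapT => ux; apply: u0; exists x; apply/negP.
  have := uuE; rewrite /ip (_ : (fun x => u x * u x) = (fun _ => 0)).
    by rewrite (mean_cst Y x0) => l0; have := lam_gt0; rewrite -l0 ltxx.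
  by apply/funext => x; rewrite u00 mul0r.
(* The defect itself is a legitimate test vector, so it has norm 0. *)
pose w x := lam * u x + (-1) * kernel_op (kernel_op u) x.
have Ww : W w by apply: WD; [exact: WZ|apply: WZ; do 2 apply: Wop].
have cw := Wcts Ww.
have w0' : ip w w = 0.
  have cPP := kernel_op_continuous cPu.
  rewrite {1}/w ipDl//; try exact: ctsZ.
  by rewrite !ipZl// key// (kernel_op_selfadjoint cPu cw); ring.
move=> x; have := ip_eq0 cw w0' x; rewrite /w mulN1r => /subr0_eq ->.
by [].
Qed.

(** The eigenspace E of a positive eigenvalue l is finite dimensional: for an
    orthonormal family e of r elements, the Bessel inequality bounds the sum of
    the (l e_i)^2 pointwise by 1, and taking means gives l^2 r <= 1.
    Translations act on E through commuting matrices, and a common complex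
    eigenvector of these matrices is an eigenfunction. *)
Lemma complex_eigenfunction : exists u v : L -> R,
  [/\ W u, W v, exists x, u x +i* v x != 0 &
    forall g, exists z : R[i], forall x, u (Y g x) +i* v (Y g x) = z * (u x +i* v x)].
Proof.
have [l [u0 [l0 Wu0 [xu u0x] u0E]]] := kernel_op_eigenvector.
pose E f := W f /\ forall x, kernel_op (kernel_op f) x = l * f x.
have Ec f : E f -> continuous f by case=> /Wcts.
have ED f h : E f -> E h -> E (fun x => f x + h x).
  move=> Ef Eh; have cf := Ec _ Ef; have ch := Ec _ Eh.
  case: Ef Eh => Wf fE [Wh hE]; split; first exact: WD.
  move=> x; rewrite kernel_opD// kernel_opD; try exact: kernel_op_continuous.
  by rewrite fE hE mulrDr.
have EZ c f : E f -> E (fun x => c * f x).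
  move=> Ef; have cf := Ec _ Ef; case: Ef => Wf fE; split; first exact: WZ.
  move=> x; rewrite kernel_opZ// kernel_opZ; last exact: kernel_op_continuous.
  by rewrite fE; ring.
have EY g f : E f -> E (fun x => f (Y g x)).
  move=> Ef; have cf := Ec _ Ef; case: Ef => Wf fE; split; first exact: WY.
  move=> x; rewrite kernel_op_translate// kernel_op_translate; last exact: kernel_op_continuous.
  exact: fE.
have ES r (c : 'I_r -> R) (e : 'I_r -> L -> R) f : E f -> (forall i, E (e i)) ->
    E (fun x => \sum_i c i * e i x).
  move=> Ef Ee; have E0 : E (fun=> 0).
    by rewrite (_ : (fun=> 0) = (fun x => 0 * f x)); [exact: EZ|apply/funext => x; rewrite mul0r].
  have : forall s : seq 'I_r, E (fun x => \sum_(i <- s) c i * e i x); last exact.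
  elim=> [|i s IH]; first by rewrite (_ : (fun x => _) = (fun=> 0))//; apply/funext => x; rewrite big_nil.
  rewrite (_ : (fun x => _) = (fun x => c i * e i x + \sum_(i <- s) c i * e i x)); last first.
    by apply/funext => x; rewrite big_cons.
  by apply: ED => //; exact: EZ.
pose P r := `[< exists e : 'I_r -> L -> R, (forall i, E (e i)) /\ orthonormal e >].
have exP : exists r, P r.
  by exists 0%N; apply/asboolP; exists (fun _ _ => 0); split=> [[]|[]].
(* The bound r <= l^-2 on the size of orthonormal families in E. *)
have bP r : P r -> (r <= Num.bound (l ^- 2))%N.
  move=> /asboolP[e [Ee oe]]; have ce i := Ec _ (Ee i).
  rewrite -(ler_nat R); apply/ltW/(le_lt_trans _ (archi_boundP _)); last by rewrite invr_ge0 sqr_ge0.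
  rewrite -[leRHS]mul1r ler_pdivlMr ?exprn_gt0//.
  have pt x : \sum_i (l * e i x) ^+ 2 <= 1.
    have cd : continuous (d x) by exact: kernel_continuous.
    have cPd := kernel_op_continuous cd.
    have ip_le1 f : continuous f -> (forall y, `|f y| <= 1) -> ip f f <= 1.
      move=> cf f1; rewrite -[leRHS](mean_cst Y x0); apply: mean_le => // [||y].
      - exact: ctsM.
      - exact: cts_cst.
      - by rewrite -expr2 -real_normK ?num_real// -(expr1n _ 2) ler_pXn2r ?nnegrE.
    apply: (@le_trans _ _ (ip (kernel_op (d x)) (kernel_op (d x)))); last first.
      apply: (ip_le1) => // y. apply: kernel_op_unit_le => //. by apply: ip_le1.
    apply: le_trans (bessel ce oe cPd); rewrite le_eqVlt; apply/orP; left; apply/eqP.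
    apply: eq_bigr => i _; congr (_ ^+ 2).
    by rewrite -(Ee i).2 {1}/kernel_op kernel_op_selfadjoint.
  rewrite -[leRHS](mean_cst Y x0).
  apply: (@le_trans _ _ (mean Y (fun x => \sum_i (l * e i x) ^+ 2))).
    have ci i : continuous (fun x => (l * e i x) ^+ 2) by apply: ctsM; exact: ctsZ.
    rewrite (mean_sum Yeq Ymin x0)//.
    rewrite (_ : \sum_i _ = \sum_(i < r) l ^+ 2); last first.
      apply: eq_bigr => i _; rewrite -[LHS]/(ip (fun x => l * e i x) (fun x => l * e i x)).
      by rewrite ipZl ?ipZr//; [rewrite oe eqxx mulr1 expr2|exact: ctsZ].
    by rewrite sumr_const card_ord mulr_natl.
  apply: mean_le => //; last exact: cts_cst.
  by apply: cts_sum => i; apply: ctsM; exact: ctsZ.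
have [r /asboolP[e [Ee oe]] rmax] := ex_maxnP exP bP.
have ce i := Ec _ (Ee i).
(* An element of E outside the span would extend the maximal orthonormal family
   by its normalized residue. *)
have span f : E f -> f = fun x => \sum_i ip f (e i) * e i x.
  move=> Ef; have cf := Ec _ Ef; pose p x := \sum_i ip f (e i) * e i x.
  pose q x := f x + (-1) * p x.
  have Ep : E p by exact: ES Ef Ee.
  have Eq : E q by apply: ED => //; exact: EZ.
  have cp := Ec _ Ep; have cq := Ec _ Eq.
  have qe i : ip q (e i) = 0.
    rewrite ipDl ?ipZl//; last exact: ctsZ.
    by rewrite (ipC p) ip_lin_orthonormal//; ring.
  have [q0|q0] := eqVneq (ip q q) 0.
    by apply/funext => x; have := ip_eq0 cq q0 x; rewrite /q mulN1r => /subr0_eq.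
  have qp : 0 < ip q q by rewrite lt_neqAle eq_sym q0 ip_ge0.
  pose c := Num.sqrt (ip q q)^-1.
  have c2 : c * c = (ip q q)^-1 by rewrite -expr2 sqr_sqrtr// invr_ge0 ltW.
  have : P r.+1.
    apply/asboolP; exists (fun i => if unlift ord0 i is Some j then e j else fun x => c * q x).
    split=> [i|i j]; first by case: unliftP => [j _|_]; [exact: Ee|exact: EZ].
    case: (unliftP ord0 i) => [i' ->|->]; case: (unliftP ord0 j) => [j' ->|->].
    - by rewrite oe (inj_eq lift_inj).
    - by rewrite ipZr// ipC qe mulr0 eq_sym (negbTE (neq_lift _ _)).
    - by rewrite ipZl// qe mulr0 (negbTE (neq_lift _ _)).
    - by rewrite ipZl ?ipZr ?mulrA ?c2 ?mulVf ?eqxx//; exact: ctsZ.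
  by move=> /rmax; rewrite ltnn.
have r0 : (0 < r)%N.
  rewrite lt0n; apply/eqP => r0; have := span u0 (conj Wu0 u0E).
  move=> /(congr1 (fun f => f xu)) /=; rewrite big1 => [h|i _].
    by rewrite h eqxx in u0x.
  by exfalso; move: i; rewrite r0 => -[].
pose A g : 'M[R]_r := \matrix_(i, j) ip (fun x => e i (Y g x)) (e j).
have AE g i x : e i (Y g x) = \sum_j A g i j * e j x.
  have := span _ (EY g _ (Ee i)) => /(congr1 (fun f => f x)) /= ->.
  by apply: eq_bigr => j _; rewrite mxE.
have AD (g h : G) : A (g + h) = A g *m A h.
  apply/matrixP => i k; rewrite !mxE.
  rewrite -[RHS](@ip_lin_orthonormal r e (fun k => \sum_j A g i j * A h j k) k)// ipC.
  congr ip; apply/funext => x; rewrite actD AE.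
  under eq_bigr => j _ do rewrite AE mulr_sumr.
  rewrite exchange_big /=; apply: eq_bigr => j _; rewrite mulr_suml.
  by apply: eq_bigr => m _; rewrite mulrA.
pose AC g : 'M[R[i]]_r := map_mx (real_complex R) (A g).
have [g h|w w_neq0 wE] := @commuting_family_eigenvector R[i] G r AC r0.
  by rewrite -!map_mxM -!AD addrC.
pose u x := \sum_i complex.Re (w ord0 i) * e i x.
pose v x := \sum_i complex.Im (w ord0 i) * e i x.
have uvE x : u x +i* v x = \sum_i w ord0 i * (e i x)%:C.
  apply/eqP; rewrite eq_complex; apply/andP; split; apply/eqP => /=.
    rewrite (big_morph _ (@raddfD _ _ (@complex.Re R : {additive _ -> _})) erefl).
    by apply: eq_bigr => i _; case: (w ord0 i) => a b /=; rewrite mulr0 subr0.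
  rewrite (big_morph _ (@raddfD _ _ (@complex.Im R : {additive _ -> _})) erefl).
  by apply: eq_bigr => i _; case: (w ord0 i) => a b /=; rewrite mulr0 add0r.
have Eu : E u by exact: ES (conj Wu0 u0E) Ee.
have Ev : E v by exact: ES (conj Wu0 u0E) Ee.
exists u, v; split; [exact: Eu.1|exact: Ev.1| |].
- apply: contrapT => uv0.
  have uv00 x : u x = 0 /\ v x = 0.
    have : u x +i* v x = 0 by apply/eqP; apply: contrapT => ux; apply: uv0; exists x; apply/negP.
    by case.
  move/eqP: w_neq0; apply; apply/rowP => i; rewrite mxE.
  have wr : complex.Re (w ord0 i) = 0.
    rewrite -(@ip_lin_orthonormal r e (fun i => complex.Re (w ord0 i)) i)//.
    rewrite /ip -[RHS](mean_cst Y x0); congr mean; apply/funext => x.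
    by rewrite -/(u x) (uv00 x).1 mulr0.
  have wi : complex.Im (w ord0 i) = 0.
    rewrite -(@ip_lin_orthonormal r e (fun i => complex.Im (w ord0 i)) i)//.
    rewrite /ip -[RHS](mean_cst Y x0); congr mean; apply/funext => x.
    by rewrite -/(v x) (uv00 x).2 mulr0.
  by case: (w ord0 i) wr wi => a b /= -> ->.
- move=> g; have [z zE] := wE g; exists z => x; rewrite !uvE.
  under eq_bigr => i _ do rewrite AE rmorph_sum mulr_sumr.
  rewrite exchange_big mulr_sumr; apply: eq_bigr => j _ /=.
  have := congr1 (fun v : 'rV[R[i]]_r => v ord0 j) zE; rewrite !mxE mulrA => <-.
  rewrite mulr_suml; apply: eq_bigr => i _.
  by rewrite !mxE rmorphM /= mulrA.
Qed.

End InvariantSubspace.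
End Spectral.

(** * Eigenmaps separate points *)
Section Eigenfunctions.
Variables (R : realType) (G : topologicalZmodType) (L : uniformType) (Y : flow G L).
Hypotheses (Yeq : equicontinuous_flow Y) (Ymin : flow_minimal Y).
Variable x0 : L.
Implicit Types (e : L -> circle R) (f u v : L -> R) (g : G).

(** Up to the choice of a base point, these are the continuous characters of the
    compact abelian group that a minimal equicontinuous flow carries. *)
Definition eigenmap e := continuous e /\
  forall g, exists a : circle R, forall x, e (Y g x) = a + e x.

Lemma minimal_invariant_const f : continuous f -> invariant_function Y f -> forall x y, f x = f y.
Proof.
move=> cf fi x y; apply/eqP; apply: contrapT => /negP fxy.
have fp : 0 < `|f y - f x| by rewrite normr_gt0 subr_eq0 eq_sym.
pose O := f @^-1` ball (f y) `|f y - f x|.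
have oO : open O.
  by apply: open_comp => [z _|]; [exact: cf|exact: ball_open].
have [z [Oz [g _ gz]]] := Ymin x (ex_intro O y (ballxx _ fp)) oO.
by move: Oz; rewrite -gz /O /= /ball /= fi ltxx.
Qed.

(** The factor z of g multiplies the bounded function u^2 + v^2 by |z|^2; the
    same bound for - g forces |z| = 1. So u^2 + v^2 is invariant, hence a
    positive constant, and u + iv can be divided by its modulus. *)
Lemma eigenmap_normalize u v : continuous u -> continuous v ->
  (exists x, u x +i* v x != 0) ->
  (forall g, exists z : R[i], forall x, u (Y g x) +i* v (Y g x) = z * (u x +i* v x)) ->
  exists (rho : R) e, [/\ eigenmap e, forall x, u x = rho * cosz (e x)
    & forall x, v x = rho * sinz (e x)].
Proof.
move=> cu cv [x1 x1n] uvE; pose n x := u x ^+ 2 + v x ^+ 2.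
have cn : continuous n by apply: ctsD; exact: ctsM.
have /choice[z zE] := uvE; pose s g := complex.Re (z g) ^+ 2 + complex.Im (z g) ^+ 2.
have uE g x : u (Y g x) = complex.Re (z g) * u x - complex.Im (z g) * v x.
  by have := zE g x; case: (z g) => a b [].
have vE g x : v (Y g x) = complex.Re (z g) * v x + complex.Im (z g) * u x.
  by have := zE g x; case: (z g) => a b [].
have nE g x : n (Y g x) = s g * n x by rewrite /n uE vE /s; ring.
have n0 x : 0 <= n x by rewrite addr_ge0 ?sqr_ge0.
have s0 g : 0 <= s g by rewrite addr_ge0 ?sqr_ge0.
have n1 : 0 < n x1.
  rewrite lt_neqAle n0 andbT eq_sym; apply: contra x1n.
  rewrite paddr_eq0 ?sqr_ge0// !sqrf_eq0 => /andP[/eqP -> /eqP ->].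
  by rewrite eq_complex /= eqxx.
have T0 : [set: L] !=set0 by exists x1.
have [M _ Mmax] := compact_EVT_max T0 (flow_compact Y) (continuous_subspaceT cn).
have nM : 0 < n M by apply: lt_le_trans n1 _; apply: Mmax; rewrite inE.
have s1 g : s g <= 1.
  have := Mmax (Y g M); rewrite inE nE => /(_ Logic.I).
  by rewrite -[leRHS]mul1r ler_pM2r.
have sE g : s g = 1.
  apply/eqP; rewrite eq_le s1 /=; have := nE (- g) (Y g M).
  rewrite flow_actA addNr act0 nE mulrA => /eqP.
  rewrite -[X in X == _]mul1r (inj_eq (mulIf (lt0r_neq0 nM))) => /eqP.
  by have := s1 (- g); have := s0 g; have := s1 g; nra.
have nc x : n x = n x1.
  by apply: minimal_invariant_const => // g {}x; rewrite nE sE mul1r.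
pose rho := Num.sqrt (n x1); have rho0 : 0 < rho by rewrite sqrtr_gt0.
have rho2 : rho ^+ 2 = n x1 by rewrite sqr_sqrtr// ltW.
have cs x : (u x / rho) ^+ 2 + (v x / rho) ^+ 2 = 1.
  by rewrite !expr_div_n -mulrDl -/(n x) nc rho2 divff// gt_eqF.
have cdiv f : continuous f -> continuous (fun x => f x / rho).
  by move=> cf; apply: ctsM => //; exact: cts_cst.
exists rho, (fun x => mk_circle (cs x)); split.
- split; first by apply: continuous_circle; apply: cdiv.
  move=> g; exists (mk_circle (sE g)) => x; apply: circle_eqP;
    rewrite ?coszD ?sinzD /cosz /sinz /= ?uE ?vE; ring.
- by move=> x; rewrite /cosz /= mulrC divfK// gt_eqF.
- by move=> x; rewrite /sinz /= mulrC divfK// gt_eqF.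
Qed.

Lemma cosz_eigenmap_continuous e : eigenmap e -> continuous (fun x => cosz (e x)).
Proof.
by case=> ce _ x; apply: continuous_comp; [exact: ce|exact: cosz_continuous].
Qed.

Lemma sinz_eigenmap_continuous e : eigenmap e -> continuous (fun x => sinz (e x)).
Proof.
by case=> ce _ x; apply: continuous_comp; [exact: ce|exact: sinz_continuous].
Qed.

Section Kernel.
Variable d : L -> L -> R.
Hypotheses (d_le1 : forall x y, `|d x y| <= 1) (d_sym : forall x y, d x y = d y x)
  (d_inv : forall g x y, d (Y g x) (Y g y) = d x y)
  (d_lip : forall x y z, `|d x z - d y z| <= d x y)
  (d_small : forall t, 0 < t -> exists2 D : set (L * L), entourage D &
    forall x y, D (x, y) -> d x y <= t).

Let cop f : continuous f -> continuous (kernel_op Y d f).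
Proof. exact: kernel_op_continuous. Qed.

(** The image of e under the operator transforms under G in the same way as e,
    so the quotient of the two is invariant, hence a constant a + ib. *)
Lemma kernel_op_eigenmap e : eigenmap e -> exists a b : R, forall x,
  kernel_op Y d (fun y => cosz (e y)) x = a * cosz (e x) - b * sinz (e x) /\
  kernel_op Y d (fun y => sinz (e y)) x = a * sinz (e x) + b * cosz (e x).
Proof.
move=> eig; have c := cosz_eigenmap_continuous eig.
have s := sinz_eigenmap_continuous eig.
pose u := kernel_op Y d (fun y => cosz (e y)); pose v := kernel_op Y d (fun y => sinz (e y)).
have cu : continuous u by exact: cop.
have cv : continuous v by exact: cop.
have [ce eE] := eig; have /choice[a aE] := eE.
have uE g x : u (Y g x) = cosz (a g) * u x - sinz (a g) * v x.
  rewrite -[LHS](congr1 (fun f => f x) (kernel_op_translate Yeq Ymin x0 d_sym d_inv d_lip d_small g c)).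
  have -> : (fun x => cosz (e (Y g x))) =
      (fun x => cosz (a g) * cosz (e x) + (- sinz (a g)) * sinz (e x)).
    by apply/funext => y; rewrite aE coszD mulNr.
  rewrite (kernel_opD Yeq Ymin x0 d_sym d_lip d_small (ctsZ c) (ctsZ s)).
  rewrite (kernel_opZ Yeq Ymin x0 d_sym d_lip d_small _ c).
  by rewrite (kernel_opZ Yeq Ymin x0 d_sym d_lip d_small _ s) mulNr.
have vE g x : v (Y g x) = cosz (a g) * v x + sinz (a g) * u x.
  rewrite -[LHS](congr1 (fun f => f x) (kernel_op_translate Yeq Ymin x0 d_sym d_inv d_lip d_small g s)).
  have -> : (fun x => sinz (e (Y g x))) =
      (fun x => cosz (a g) * sinz (e x) + sinz (a g) * cosz (e x)).
    by apply/funext => y; rewrite aE sinzD.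
  rewrite (kernel_opD Yeq Ymin x0 d_sym d_lip d_small (ctsZ s) (ctsZ c)).
  rewrite (kernel_opZ Yeq Ymin x0 d_sym d_lip d_small _ c).
  by rewrite (kernel_opZ Yeq Ymin x0 d_sym d_lip d_small _ s).
pose P x := u x * cosz (e x) + v x * sinz (e x).
pose Q x := v x * cosz (e x) - u x * sinz (e x).
have PE x : P x = P x0.
  apply: minimal_invariant_const => [|g {}x]; first by apply: ctsD; exact: ctsM.
  rewrite /P uE vE aE coszD sinzD; have := coszE2 (a g) => h.
  transitivity ((cosz (a g) ^+ 2 + sinz (a g) ^+ 2) * (u x * cosz (e x) + v x * sinz (e x))).
    by ring.
  by rewrite h mul1r.
have QE x : Q x = Q x0.
  apply: minimal_invariant_const => [|g {}x]; first by apply: ctsB; exact: ctsM.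
  rewrite /Q uE vE aE coszD sinzD; have := coszE2 (a g) => h.
  transitivity ((cosz (a g) ^+ 2 + sinz (a g) ^+ 2) * (v x * cosz (e x) - u x * sinz (e x))).
    by ring.
  by rewrite h mul1r.
exists (P x0), (Q x0) => x; rewrite -(PE x) -(QE x) -/(u x) -/(v x) /P /Q.
have h := coszE2 (e x); split.
  by transitivity ((cosz (e x) ^+ 2 + sinz (e x) ^+ 2) * u x); [rewrite h mul1r|ring].
by transitivity ((cosz (e x) ^+ 2 + sinz (e x) ^+ 2) * v x); [rewrite h mul1r|ring].
Qed.

(** The orthogonal complement of all eigenmaps. *)
Let W f := continuous f /\ forall e, eigenmap e ->
  ip Y f (fun x => cosz (e x)) = 0 /\ ip Y f (fun x => sinz (e x)) = 0.

Let WD f h : W f -> W h -> W (fun x => f x + h x).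
Proof.
move=> [cf fe] [ch he]; split; first exact: ctsD.
move=> e ee; have [f1 f2] := fe _ ee; have [h1 h2] := he _ ee.
have c := cosz_eigenmap_continuous ee.
have s := sinz_eigenmap_continuous ee.
by rewrite !(ipDl Yeq Ymin x0)// f1 f2 h1 h2 !addr0.
Qed.

Let WZ c f : W f -> W (fun x => c * f x).
Proof.
move=> [cf fe]; split; first exact: ctsZ.
move=> e ee; have [f1 f2] := fe _ ee; have cce := cosz_eigenmap_continuous ee.
have s := sinz_eigenmap_continuous ee.
by rewrite !(ipZl Yeq Ymin x0)// f1 f2 !mulr0.
Qed.

Let eigenmap_translate g e : eigenmap e -> eigenmap (fun x => e (Y g x)).
Proof.
move=> [ce eE]; split.
  by move=> x; apply: continuous_comp; [exact: flow_act_continuous|exact: ce].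
move=> h; have [a aE] := eE h; exists a => x.
by rewrite flow_actA addrC -flow_actA aE.
Qed.

Let WY g f : W f -> W (fun x => f (Y g x)).
Proof.
move=> [cf fe]; split; first exact: cts_translate.
move=> e /(eigenmap_translate (- g)) ee; have [f1 f2] := fe _ ee.
have h x : x = Y (- g) (Y g x) by rewrite flow_actA addNr act0.
split.
- rewrite -[RHS]f1 /ip -[RHS](mean_inv Yeq Ymin x0 g); last first.
    by apply: ctsM => //; exact: cosz_eigenmap_continuous.
  by congr mean; apply/funext => x; rewrite -h.
- rewrite -[RHS]f2 /ip -[RHS](mean_inv Yeq Ymin x0 g); last first.
    by apply: ctsM => //; exact: sinz_eigenmap_continuous.
  by congr mean; apply/funext => x; rewrite -h.
Qed.

Let Wop f : W f -> W (kernel_op Y d f).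
Proof.
move=> [cf fe]; split; first exact: cop.
move=> e ee; have [f1 f2] := fe _ ee; have c := cosz_eigenmap_continuous ee.
have s := sinz_eigenmap_continuous ee.
have [a [b ab]] := kernel_op_eigenmap ee.
rewrite !(kernel_op_selfadjoint Yeq Ymin x0 d_le1 d_sym d_lip d_small)//.
have -> : kernel_op Y d (fun y => cosz (e y)) = fun x => a * cosz (e x) + (- b) * sinz (e x).
  by apply/funext => x; rewrite (ab x).1 mulNr.
have -> : kernel_op Y d (fun y => sinz (e y)) = fun x => a * sinz (e x) + b * cosz (e x).
  by apply/funext => x; rewrite (ab x).2.
have cz (r : R) (h : L -> R) : continuous h -> continuous (fun x => r * h x) by exact: ctsZ.
rewrite !(ipDr Yeq Ymin x0) ?(ipZr Yeq Ymin x0)//; try exact: cz.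
by rewrite f1 f2 !mulr0 addr0.
Qed.

Let Wlim u : (forall t, 0 < t -> exists2 f, W f & forall x, `|f x - u x| <= t) -> W u.
Proof.
move=> H.
have cu : continuous u.
  apply: has_modulus_continuous => t t0; have t3 : 0 < t / 3 by rewrite divr_gt0.
  have [f [cf _] fu] := H _ t3.
  have [D entD Df] := continuous_has_modulus (flow_compact Y) cf t3.
  exists D => // x y /Df fxy; have h1 := fu x; have h2 := fu y; rewrite distrC in h1.
  rewrite (_ : u x - u y = (u x - f x) + (f x - f y) + (f y - u y)); last by ring.
  apply: le_trans (ler_normD _ _) _.
  by have := ler_normD (u x - f x) (f x - f y); lra.
split=> // e ee; have c := cosz_eigenmap_continuous ee.
have s := sinz_eigenmap_continuous ee.
have key (h : L -> R) : continuous h -> (forall x, `|h x| <= 1) ->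
    (forall f, W f -> ip Y f h = 0) -> ip Y u h = 0.
  move=> ch h1 fh; apply/eqP; rewrite -normr_le0; apply/ler_addgt0Pr => t t0.
  have [f Wf fu] := H _ t0; rewrite add0r -[ip Y u h]subr0 -(fh f Wf).
  have cf := Wf.1.
  apply: (mean_dist Yeq Ymin x0) => [||x]; try exact: ctsM.
  rewrite -mulrBl normrM -[leRHS]mulr1; apply: ler_pM => //.
  by rewrite distrC.
have cs1 z : `|cosz z : R| <= 1 /\ `|sinz z : R| <= 1.
  have := coszE2 z; have := sqr_ge0 (cosz z); have := sqr_ge0 (sinz z).
  by rewrite !ler_norml => *; split; apply/andP; split; nra.
split; apply: key => // [x|f [_ /(_ e ee)[]] //].
- exact: (cs1 (e x)).1.
- exact: (cs1 (e x)).2.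
Qed.

(** Suppose that no eigenmap separates a from b. Then w = d a - d b is
    orthogonal to all eigenmaps, and the operator does not kill w since its
    values at a and b differ by |w|^2. So the orthogonal complement of the
    eigenmaps contains an eigenfunction; normalized, it is an eigenmap
    orthogonal to itself. *)
Lemma eigenmap_separates_kernel a b : d a b != 0 -> d a a = 0 ->
  exists2 e, eigenmap e & e a != e b.
Proof.
move=> dab daa; apply: contrapT => nsep.
have eab e : eigenmap e -> e a = e b.
  by move=> ee; apply/eqP; apply: contrapT => /negP eab; apply: nsep; exists e.
have cd x : continuous (d x) by exact: kernel_continuous.
pose w x := d a x + (-1) * d b x.
have cz : continuous (fun x => -1 * d b x) by exact: ctsZ.
have Ww : W w.
  split; first exact: ctsD.
  move=> e ee; have c := cosz_eigenmap_continuous ee.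
have s := sinz_eigenmap_continuous ee.
  have [p [q pq]] := kernel_op_eigenmap ee.
  rewrite !(ipDl Yeq Ymin x0) ?(ipZl Yeq Ymin x0)//.
  rewrite -!/(kernel_op Y d _ _) !(pq _).1 !(pq _).2 (eab e ee).
  by split; ring.
have ww : ip Y w w != 0.
  apply/eqP => /(ip_eq0 Yeq Ymin x0 Ww.1)/(_ a); rewrite /w daa add0r mulN1r d_sym.
  by move=> /eqP; rewrite oppr_eq0 (negbTE dab).
have [x1 x1n] : exists x, kernel_op Y d w x != 0.
  apply: contrapT => P0; move/eqP: ww; apply.
  have P00 x : kernel_op Y d w x = 0.
    by apply/eqP; apply: contrapT => Px; apply: P0; exists x; apply/negP.
  rewrite {1}/w (ipDl Yeq Ymin x0) ?(ipZl Yeq Ymin x0)//; try exact: Ww.1.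
  by rewrite -!/(kernel_op Y d _ _) !P00 mulr0 addr0.
have [u [v [Wu Wv uv0 uvE]]] := complex_eigenfunction Yeq Ymin x0 d_le1 d_sym d_inv
  d_lip d_small (fun f (Wf : W f) => Wf.1) WD WZ WY Wop Wlim Ww x1n.
have [rho [e [ee uE vE]]] := eigenmap_normalize Wu.1 Wv.1 uv0 uvE.
have c := cosz_eigenmap_continuous ee.
have s := sinz_eigenmap_continuous ee.
have u0 x : u x = 0.
  apply: (ip_eq0 Yeq Ymin x0 Wu.1).
  rewrite {2}(_ : u = (fun x => rho * cosz (e x))); last exact/funext.
  by rewrite (ipZr Yeq Ymin x0)// ?(Wu.2 e ee).1 ?mulr0//; exact: Wu.1.
have v0 x : v x = 0.
  apply: (ip_eq0 Yeq Ymin x0 Wv.1).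
  rewrite {2}(_ : v = (fun x => rho * sinz (e x))); last exact/funext.
  by rewrite (ipZr Yeq Ymin x0)// ?(Wv.2 e ee).2 ?mulr0//; exact: Wv.1.
by have [x] := uv0; rewrite u0 v0 eqxx.
Qed.

End Kernel.

Lemma eigenmap_separates a b : a != b -> exists2 e, eigenmap e & e a != e b.
Proof.
move=> ab.
have clb : closed [set b].
  by apply: accessible_closed_set1; apply: hausdorff_accessible; exact: flow_hausdorff Y.
have us : uniform_separator [set a] [set b].
  by apply: point_uniform_separator => //= ba; rewrite ba eqxx in ab.
have [f [cf f01 fa fb]] := (@uniform_separatorP _ R _ _).1 us.
have f1 x : 0 <= f x <= 1.
  by have := f01 (f x) (imageT f x); rewrite /= in_itv.
have fa0 : f a = 0 by apply: fa; exists a.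
have fb1 : f b = 1 by apply: fb; exists b.
apply: (@eigenmap_separates_kernel (orbit_dist Y f)).
- by move=> x y; rewrite ger0_norm ?orbit_dist_ge0 ?orbit_dist_le1.
- exact: orbit_dist_sym.
- exact: orbit_dist_inv.
- by move=> x y z; exact: orbit_dist_lip.
- by move=> e e0; exact: orbit_dist_small.
- have := orbit_dist_ge Y f1 0 a b; rewrite !act0 fa0 fb1 sub0r normrN normr1.
  by move=> /(lt_le_trans ltr01)/lt0r_neq0.
- exact: orbit_dist_xx.
Qed.

End Eigenfunctions.

(** * Independent eigenmaps fill the torus *)
(** Induction on N: consecutive central coefficients have ratio 2 (2N + 1) / (N
    + 1), and (2N + 3) / (N + 1) >= 2. *)
Lemma central_bin_ge N : (4 ^ N <= N.*2.+1 * 'C(N.*2, N))%N.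
Proof.
elim: N => [|N IH]; first by rewrite bin0.
have h1 : (N.+1 * 'C(N.*2.+2, N.+1) = N.*2.+2 * 'C(N.*2.+1, N))%N.
  by rewrite -mul_bin_diag.
have h2 : (N.+1 * 'C(N.*2.+1, N) = N.*2.+1 * 'C(N.*2, N))%N.
  by have := mul_bin_down N.*2.+1 N; rewrite /= => ->; congr (_ * _)%N; lia.
rewrite doubleS expnS -(leq_pmul2l (ltn0Sn N)).
nia.
Qed.

(** For 1/q = 1 + s, the Bernoulli inequality gives (1 + s)^(k (m + 1)) >= (k
    s)^(m + 1), which has one more power of k than the polynomial factor at N =
    k (m + 1). *)
Lemma poly_mul_exp_lt1 (R : realType) m (q : R) : 0 <= q < 1 ->
  exists N, (N.*2.+1)%:R ^+ m * q ^+ N < 1.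
Proof.
move=> /andP[]; rewrite le_eqVlt => /orP[/eqP <- _|q0 q1].
  by exists 1%N; rewrite expr1 mulr0.
pose s := q^-1 - 1; have s0 : 0 < s by rewrite subr_gt0 invf_gt1.
have sE : q^-1 = 1 + s by rewrite /s; ring.
have bern k : 1 + k%:R * s <= (1 + s) ^+ k.
  elim: k => [|k IH]; first by rewrite mul0r addr0 expr0.
  rewrite exprS -natr1; have : 0 <= k%:R :> R by []; nra.
pose c := (3 * m.+1)%:R ^+ m / s ^+ m.+1.
have c0 : 0 <= c by rewrite divr_ge0 ?exprn_ge0// ltW.
pose k := (Num.bound c).+1.
have kc : c < k%:R by apply: lt_trans (archi_boundP c0) _; rewrite ltr_nat.
have k0 : 0 < k%:R :> R by rewrite ltr0n.
exists (m.+1 * k)%N.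
rewrite -ltr_pdivlMr ?exprn_gt0// mul1r -exprVn sE mulnC exprM.
apply: (@lt_le_trans _ _ ((k%:R * s) ^+ m.+1)); last first.
  have ks : k%:R * s <= (1 + s) ^+ k by apply: le_trans (bern k); rewrite lerDr.
  have ks0 : 0 <= k%:R * s by rewrite mulr_ge0// ltW.
  by apply: lerXn2r => //; rewrite nnegrE//; exact: le_trans ks.
apply: (@le_lt_trans _ _ ((3 * m.+1)%:R ^+ m * k%:R ^+ m)).
  by rewrite -exprMn -natrM; apply: lerXn2r; rewrite ?nnegrE// ler_nat /k; nia.
have PS : (3 * m.+1)%:R ^+ m < k%:R * s ^+ m.+1.
  by rewrite -ltr_pdivrMr ?exprn_gt0.
by rewrite exprMn [k%:R ^+ m.+1]exprS mulrAC ltr_pM2r ?exprn_gt0.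
Qed.

Section Fejer.
Variable R : realType.
Implicit Types t : circle R.

Lemma val_circleD s t : val (s + t) = val s * val t :> R[i]. Proof. by []. Qed.
Lemma val_circle0 : val (0 : circle R) = 1 :> R[i]. Proof. by []. Qed.

Lemma val_circleMn t k : val (t *+ k) = val t ^+ k :> R[i].
Proof. by elim: k => [|k IH]; rewrite ?mulr0n ?expr0// mulrS exprS val_circleD IH. Qed.

Lemma val_circle_sum (I : finType) (F : I -> circle R) :
  val (\sum_i F i) = \prod_i (val (F i) : R[i]).
Proof. by rewrite (big_morph _ val_circleD val_circle0). Qed.

(** With z for the point t of the complex unit circle, (1 + z)^2 / z = 2 + z +
    1/z = 2 + 2 cos t. *)
Lemma circle_square t :
  (1 + val t : R[i]) ^+ 2 * val (- t) = (4 * ((1 + cosz t) / 2))%:C.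
Proof.
have h := coszE2 t.
have -> : val t = cosz t +i* sinz t :> R[i] by rewrite /cosz /sinz; case: (t) => [[]].
have -> : val (- t) = cosz t +i* (- sinz t) :> R[i].
  by rewrite -coszN -sinzN /cosz /sinz; case: (- t) => [[]].
have {}h : sinz t ^+ 2 = 1 - cosz t ^+ 2 by rewrite -h; ring.
apply/eqP; rewrite eq_complex /=; apply/andP; split; apply/eqP.
  by field: h.
by ring: h.
Qed.

Lemma fejer_expand t N : (((1 + cosz t) / 2) ^+ N)%:C =
  \sum_(k < N.*2.+1) ('C(N.*2, k)%:R / 4 ^+ N)%:C * (val (t *~ (k%:Z - N%:Z)) : R[i]).
Proof.
have c4 : (4 ^+ N)%:C != 0 :> R[i] by rewrite (inj_eq (@complexI R)) expf_neq0.
apply: (mulfI c4).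
transitivity ((1 + val t : R[i]) ^+ N.*2 * val (- t) ^+ N).
  by rewrite -mul2n exprM -exprMn circle_square -[RHS]rmorphXn [in RHS]exprMn [RHS]rmorphM.
rewrite exprDn mulr_suml mulr_sumr; apply: eq_bigr => k _.
rewrite expr1n mul1r mulrA -rmorphM mulrC [4 ^+ N * _]mulrC divfK ?expf_neq0//.
rewrite rmorph_nat -mulr_natl mulrCA; congr (_ * _).
by rewrite mulrzBr val_circleD -mulNrz -!pmulrn !val_circleMn mulrC.

Qed.

End Fejer.

Section Surjective.
Variables (R : realType) (G : topologicalZmodType) (L : uniformType) (Y : flow G L).
Hypotheses (Yeq : equicontinuous_flow Y) (Ymin : flow_minimal Y).
Variable x0 : L.
Implicit Types (e : L -> circle R).

Lemma eigenmapD e e' : eigenmap Y e -> eigenmap Y e' -> eigenmap Y (fun x => e x + e' x).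
Proof.
move=> [ce eE] [ce' eE']; split; first exact: continuous_circleD.
move=> g; have [a aE] := eE g; have [a' aE'] := eE' g; exists (a + a') => x.
by rewrite aE aE' addrACA.
Qed.

Lemma eigenmapN e : eigenmap Y e -> eigenmap Y (fun x => - e x).
Proof.
move=> [ce eE]; split; first exact: continuous_circleN.
by move=> g; have [a aE] := eE g; exists (- a) => x; rewrite aE opprD.
Qed.

Lemma eigenmap_cst (a : circle R) : eigenmap Y (fun _ => a).
Proof. by split; [exact: cst_continuous|move=> g; exists 0 => x; rewrite add0r]. Qed.

Lemma eigenmapMz e k : eigenmap Y e -> eigenmap Y (fun x => e x *~ k).
Proof.
move=> ee; have Mn n : eigenmap Y (fun x => e x *+ n).
  elim: n => [|n IH]; first exact: eigenmap_cst.
  rewrite (_ : (fun x => _) = (fun x => e x + e x *+ n)); first exact: eigenmapD.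
  by apply/funext => x; rewrite mulrS.
case: k => n; first exact: Mn.
rewrite (_ : (fun x => _) = (fun x => - (e x *+ n.+1))); first exact: eigenmapN.
by apply/funext => x; rewrite NegzE mulrNz.
Qed.

Lemma eigenmap_sum (I : Type) (r : seq I) (F : I -> L -> circle R) :
  (forall i, eigenmap Y (F i)) -> eigenmap Y (fun x => \sum_(i <- r) F i x).
Proof.
move=> eF; elim: r => [|i r IH].
  rewrite (_ : (fun x => _) = (fun _ => 0)); first exact: eigenmap_cst.
  by apply/funext => x; rewrite big_nil.
rewrite (_ : (fun x => _) = (fun x => F i x + \sum_(i <- r) F i x)); first exact: eigenmapD.
by apply/funext => x; rewrite big_cons.
Qed.

(** If a is the factor of some g, invariance of the mean makes the complex mean
    of e equal to a times itself; and a can be chosen nontrivial unless e is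
    constant. *)
Lemma mean_eigenmap e : eigenmap Y e -> (exists x, e x != e x0) ->
  mean Y (fun x => cosz (e x)) = 0.
Proof.
move=> ee [x1 ex1]; have cc := cosz_eigenmap_continuous ee.
have cs := sinz_eigenmap_continuous ee.
have [g [a [aE a0]]] : exists g a, (forall x, e (Y g x) = a + e x) /\ a != 0.
  apply: contrapT => H; move/eqP: ex1; apply.
  have inv g x : e (Y g x) = e x.
    have [a aE] := ee.2 g; rewrite aE; have [->|a0] := eqVneq a 0; first by rewrite add0r.
    by exfalso; apply: H; exists g, a.
  apply: circle_eqP.
    by apply: (minimal_invariant_const Ymin cc) => g x; rewrite inv.
  by apply: (minimal_invariant_const Ymin cs) => g x; rewrite inv.
set C := mean Y _; pose S := mean Y (fun x => sinz (e x)).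
have CE : C = cosz a * C - sinz a * S.
  rewrite -[LHS](mean_inv Yeq Ymin x0 g cc) -!(meanZ Yeq Ymin x0)// -(meanB Yeq Ymin x0);
    try exact: ctsZ.
  by congr mean; apply/funext => x; rewrite aE coszD.
have SE : S = cosz a * S + sinz a * C.
  rewrite -[LHS](mean_inv Yeq Ymin x0 g cs) -!(meanZ Yeq Ymin x0)// -(meanD Yeq Ymin x0);
    try exact: ctsZ.
  by congr mean; apply/funext => x; rewrite aE sinzD.
have h := coszE2 a.
have : (2 - 2 * cosz a) * C = 0.
  have E1 : (1 - cosz a) * C + sinz a * S = 0 by lra.
  have E2 : (1 - cosz a) * S - sinz a * C = 0 by lra.
  have -> : (2 - 2 * cosz a) * C = (1 + (cosz a ^+ 2 + sinz a ^+ 2) - 2 * cosz a) * C.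
    by rewrite h.
  transitivity ((1 - cosz a) * ((1 - cosz a) * C + sinz a * S) -
    sinz a * ((1 - cosz a) * S - sinz a * C)); first by ring.
  by rewrite E1 E2 !mulr0 subr0.
move=> /eqP; rewrite mulf_eq0 => /orP[/eqP c1|/eqP //].
have ca : cosz a = 1 by lra.
exfalso; move/eqP: a0; apply; apply: circle_eqP; rewrite ?cosz0 ?sinz0//.
by apply/eqP; rewrite -sqrf_eq0; apply/eqP; have := h; rewrite ca; lra.
Qed.

(** Suppose that b is missed. The product h of the factors (1 + cos (e_i - b_i))
    / 2 is then bounded by some q < 1, so the mean of h^N is at most q^N. On the
    other hand h^N is a trigonometric polynomial in the e_i, whose nonconstant
    terms have mean 0 by independence; its constant term, the m-th power of a
    central binomial coefficient over 4^N, decays only polynomially in N. *)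
Lemma independent_eigenmaps_surj m (e : 'I_m -> L -> circle R) :
  (forall i, eigenmap Y (e i)) ->
  (forall c : 'I_m -> int, (forall x, \sum_i e i x *~ c i = \sum_i e i x0 *~ c i) ->
     forall i, c i = 0) ->
  forall b : torus R m, exists x, forall i, e i x = b ord0 i.
Proof.
move=> ee free b; apply: contrapT => nb.
pose th i x := e i x - b ord0 i.
have eth i : eigenmap Y (th i) by apply: eigenmapD => //; exact: eigenmap_cst.
pose fac i x : R := (1 + cosz (th i x)) / 2.
have fac01 i x : 0 <= fac i x <= 1.
  by have := coszE2 (th i x); rewrite /fac => h; apply/andP; split; nra.
pose h x := \prod_i fac i x.
have ch : continuous h.
  have cfac i : continuous (fac i).
    apply: ctsM; last exact: cts_cst.
    by apply: ctsD; [exact: cts_cst|exact: cosz_eigenmap_continuous].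
  by apply: continuous_big => [|i _]; [exact: mul_continuous|exact: cfac].
have h0 x : 0 <= h x by apply: prodr_ge0 => i _; have /andP[] := fac01 i x.
have h1 x : h x < 1.
  have [i thi] : exists i, th i x != 0.
    apply: contrapT => H; apply: nb; exists x => i; apply/eqP; rewrite -subr_eq0.
    by apply: contrapT => thi; apply: H; exists i; apply/negP.
  rewrite /h (bigD1 i)//=; apply: (@le_lt_trans _ _ (fac i x)).
    rewrite ler_piMr//; first by have /andP[] := fac01 i x.
    by apply: prodr_ile1 => j _; exact: fac01.
  rewrite lt_neqAle; have /andP[_ ->] := fac01 i x; rewrite andbT.
  apply: contra thi => /eqP f1; have c1 : cosz (th i x) = 1.
    by move: f1; rewrite /fac; lra.
  apply/eqP/circle_eqP; rewrite ?cosz0 ?sinz0//.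
  by apply/eqP; rewrite -sqrf_eq0; apply/eqP; have := coszE2 (th i x); rewrite c1; lra.
have T0 : [set: L] !=set0 by exists x0.
have [M _ Mmax] := compact_EVT_max T0 (flow_compact Y) (continuous_subspaceT ch).
have hM x : h x <= h M by apply: Mmax; rewrite inE.
have chN N : continuous (fun x => h x ^+ N).
  elim: N => [|N IH]; first exact: cts_cst.
  rewrite (_ : (fun x => _) = (fun x => h x * h x ^+ N)); first exact: ctsM.
  by apply/funext => x; rewrite exprS.
have mean_le_q N : mean Y (fun x => h x ^+ N) <= h M ^+ N.
  rewrite -[leRHS](mean_cst Y x0); apply: (mean_le Yeq Ymin x0) => //.
    exact: cts_cst.
  by move=> x; rewrite lerXn2r ?nnegrE.
pose r N (f : {ffun 'I_m -> 'I_N.*2.+1}) : R := \prod_i ('C(N.*2, f i)%:R / 4 ^+ N).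
pose chi N (f : {ffun 'I_m -> 'I_N.*2.+1}) x : circle R :=
  \sum_i th i x *~ ((f i)%:Z - N%:Z).
have expand N x : h x ^+ N = \sum_f r N f * cosz (chi N f x).
  have E : (h x ^+ N)%:C = \sum_f (r N f)%:C * (val (chi N f x) : R[i]).
    transitivity (\prod_i (fac i x ^+ N)%:C : R[i]).
      by rewrite /h -prodrXl rmorph_prod.
    under eq_bigr => i _ do rewrite /fac fejer_expand.
    rewrite bigA_distr_bigA /=; apply: eq_bigr => f _.
    by rewrite big_split /= -rmorph_prod val_circle_sum.
  have := congr1 (@complex.Re R) E.
  rewrite [X in X = _]/= => ->.
  rewrite (big_morph _ (@raddfD _ _ (@complex.Re R : {additive _ -> _})) erefl).
  apply: eq_bigr => f _; rewrite /cosz; case: (val _) => p q /=.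
  by rewrite mul0r subr0.
pose f0 N : {ffun 'I_m -> 'I_N.*2.+1} := [ffun=> inord N].
have f0E N i : f0 N i = N :> nat by rewrite ffunE inordK// ltnS -addnn leq_addr.
have echi N f : eigenmap Y (chi N f).
  by apply: eigenmap_sum => i; apply: eigenmapMz.
(* Independence of the e i makes every term but the constant one a nonconstant
   eigenmap. *)
have mean_chi N f : f != f0 N -> mean Y (fun x => cosz (chi N f x)) = 0.
  move=> ff0; apply: mean_eigenmap => //; apply: contrapT => H.
  move/negP: ff0; apply; apply/eqP/ffunP => i; apply: val_inj; rewrite /= f0E.
  have := @free (fun i => (f i)%:Z - N%:Z) _ i => fr.
  suff : (f i)%:Z - N%:Z = 0 by move=> /subr0_eq [].
  apply: fr => x; have : chi N f x = chi N f x0.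
    by apply/eqP; apply: contrapT => nx; apply: H; exists x; apply/negP.
  rewrite /chi /th; under eq_bigr => j _ do rewrite mulrzBl.
  under [in X in _ = X -> _]eq_bigr => j _ do rewrite mulrzBl.
  by rewrite !sumrB => /addIr.
have meanE N : mean Y (fun x => h x ^+ N) = ('C(N.*2, N)%:R / 4 ^+ N) ^+ m.
  rewrite (_ : (fun x => _) = (fun x => \sum_f r N f * cosz (chi N f x))); last first.
    by apply/funext => x; exact: expand.
  rewrite (mean_sum Yeq Ymin x0); last first.
    by move=> f; apply: ctsZ; exact: cosz_eigenmap_continuous.
  rewrite (bigD1 (f0 N))//= big1 => [|f ff0]; last first.
    by rewrite (meanZ Yeq Ymin x0) ?mean_chi ?mulr0//; exact: cosz_eigenmap_continuous.
  rewrite addr0 (_ : (fun x => _) = (fun=> r N (f0 N))); last first.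
    apply/funext => x; rewrite /chi big1 ?cosz0 ?mulr1// => i _.
    by rewrite f0E subrr mulr0z.
  rewrite (mean_cst Y x0) /r (eq_bigr (fun=> 'C(N.*2, N)%:R / 4 ^+ N)).
    by rewrite prodr_const card_ord.
  by move=> i _; rewrite f0E.
have [|N Nlt] := @poly_mul_exp_lt1 R m (h M); first by rewrite h0 h1.
have lower : 1 <= (N.*2.+1)%:R ^+ m * ('C(N.*2, N)%:R / 4 ^+ N) ^+ m :> R.
  rewrite -exprMn exprn_ege1// mulrA ler_pdivlMr ?exprn_gt0// mul1r -natrM -natrX ler_nat.
  exact: central_bin_ge.
have := mean_le_q N; rewrite meanE => up.
move: Nlt; apply/negP; rewrite -leNgt; apply: le_trans lower _.
by rewrite ler_wpM2l// exprn_ge0.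
Qed.

End Surjective.

(** * The torus model of an equicontinuous factor *)
Section TorusModel.
Variables (R : realType) (G : topologicalZmodType) (L : uniformType) (Y : flow G L).
Hypotheses (Yeq : equicontinuous_flow Y) (Ymin : flow_minimal Y).
Variables (m : nat) (F : L -> torus R m).
Hypotheses (cF : continuous F) (F_inj : injective F) (F_surj : forall z, exists x, F x = z)
  (F_rot : forall g, exists a, forall x, F (Y g x) = a + F x).

(** The action is transported along F, which is a homeomorphism since L is
    compact and the torus is Hausdorff. *)
Lemma torus_model : exists Z : flow G (torus R m),
  [/\ flow_minimal Z, by_rotations Z & flow_isomorphic Y Z].
Proof.
have [k Fk] := choice F_surj.
have kF : cancel F k by move=> x; apply: F_inj; rewrite Fk.
have ck : continuous k.
  apply: (@continuous_of_compact_quotient L (torus R m) L F setT) => //.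
  - exact: flow_compact Y.
  - exact: torus_hausdorff.
  - by move=> z; exists (k z).
  - have -> : k \o F = id by apply: funext => x /=; exact: kF.
    by move=> x A.
have cT : compact [set: torus R m].
  rewrite (_ : setT = F @` setT); last first.
    by apply/seteqP; split=> // z _; exists (k z).
  apply: continuous_compact; first exact: continuous_subspaceT.
  exact: flow_compact Y.
pose act' g z := F (Y g (k z)).
have a0 z : act' 0 z = z by rewrite /act' act0 Fk.
have aD g h z : act' (g + h) z = act' g (act' h z) by rewrite /act' actD kF.
have ca : continuous (fun p : G * torus R m => act' p.1 p.2).
  move=> p; apply: (@continuous_comp _ _ _ (fun p : G * torus R m => Y p.1 (k p.2)) F);
    last exact: cF.
  apply: (@continuous_comp _ _ _ (fun p : G * torus R m => (p.1, k p.2))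
    (fun p => Y p.1 p.2)); last exact: act_continuous.
  apply: cvg_pair; first exact: cvg_fst.
  by apply: (@continuous_comp _ _ _ snd k); [exact: cvg_snd|exact: ck].
pose Z := Flow cT (@torus_hausdorff R m) a0 aD ca.
exists Z; split.
- move=> z O [y Oy] oO.
  have oFO : open (F @^-1` O) by apply: open_comp => // x _; exact: cF.
  have FO0 : F @^-1` O !=set0 by exists (k y); rewrite /= Fk.
  have [x [Ox [g _ gx]]] := Ymin (k z) FO0 oFO.
  by exists (F x); split => //; exists g => //=; rewrite /act' -gx.
- move=> g; have [a aE] := F_rot g; exists a => z.
  by rewrite /= /act' aE Fk.
- exists F, k; split => // g x.
  by rewrite /= /act' kF.
Qed.

End TorusModel.

Theorem corollary3p5 (R : realType) (G : topologicalZmodType) (n : nat)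
    (X : flow G (torus R n))
    (X_inv : forall f : torus R n -> R[i], continuous f ->
      invariant_function X f -> exists c : R[i], forall x, f x = c)
    (L : uniformType) (Y : flow G L) :
  flow_factor X Y -> equicontinuous_flow Y ->
  exists (m : nat) (Z : flow G (torus R m)),
    [/\ (m <= n)%N, flow_minimal Z, by_rotations Z & flow_isomorphic Y Z].
Proof.
move=> [p [cp p_surj p_eq]] Yeq.
have p_surj' y : exists x, p x = y by have [x _ xy] := p_surj y Logic.I; exists x.
have X_const (f : torus R n -> R) : continuous f -> invariant_function X f ->
    forall x y, f x = f y.
  move=> cf fi x y; have [|g z|c cE] := X_inv (fun x => (f x)%:C).
  - by apply: continuous_complex => //=; exact: cst_continuous.
  - by rewrite fi.
  - by apply: (@complexI R); rewrite !cE.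
have Ymin : flow_minimal Y.
  apply: (@minimal_of_invariant_const R) => // f cf fi x y.
  have [x' <-] := p_surj' x; have [y' <-] := p_surj' y.
  apply: (X_const (f \o p)) => [z|g z]; last by rewrite /= p_eq fi.
  by apply: continuous_comp; [exact: cp|exact: cf].
(* An eigenmap whose pullback to the source torus has degree 0 is constant: the
   pullback has a continuous logarithm, which is invariant. *)
have degree0_const (e : L -> circle R) : eigenmap Y e -> has_degree (e \o p) 0 ->
    forall x y, e x = e y.
  move=> [ce eE] /degree0_log[h ch hE] x y.
  have hi : invariant_function X h.
    apply: (eigen_degree0_invariant _ ch hE) => g; have [a aE] := eE g.
    by exists a => z; rewrite /= p_eq aE.
  have [x' <-] := p_surj' x; have [y' <-] := p_surj' y.
  by rewrite -![e (p _)]/((e \o p) _) hE [RHS]hE (X_const h ch hi x' y').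
(* The degrees of eigenmaps form a subgroup of Z^n, isomorphic to the group of
   eigenmaps modulo constants. *)
pose S k := exists2 e : L -> circle R, eigenmap Y e & has_degree (e \o p) k.
have S0 : S 0 by exists (fun _ => 0); [exact: eigenmap_cst|exact: has_degree_cst].
have SD u v : S u -> S v -> S (u + v).
  move=> [e ee eu] [f fe fv]; exists (fun x => e x + f x); first exact: eigenmapD.
  exact: has_degreeD.
have SN u : S u -> S (- u).
  move=> [e ee eu]; exists (fun x => - e x); first exact: eigenmapN.
  exact: has_degreeN.
have [m [B [mn SB span free]]] := int_lattice_basis S0 SD SN.
have /choice[e eP] : forall i, exists e : L -> circle R,
    eigenmap Y e /\ has_degree (e \o p) (B i).
  by move=> i; have [e ee eB] := SB i; exists e.
have ee i : eigenmap Y (e i) by have [] := eP i.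
have eB i : has_degree (e i \o p) (B i) by have [] := eP i.
have comb_degree (c : 'I_m -> int) :
    has_degree ((fun x => \sum_i e i x *~ c i) \o p) (\sum_i B i *~ c i).
  by apply: has_degree_sum => i; apply: has_degreeMz (eB i).
have comb_eigen (c : 'I_m -> int) : eigenmap Y (fun x => \sum_i e i x *~ c i).
  by apply: eigenmap_sum => i; exact: eigenmapMz.
pose F x : torus R m := \row_i e i x.
have cF : continuous F.
  by apply: continuous_torus => i; rewrite /F; under eq_fun do rewrite mxE; exact: (ee i).1.
(* A separating eigenmap differs from a combination of the e i by an eigenmap
   of degree 0, so some e i separates as well. *)
have F_inj : injective F.
  move=> x y Fxy; apply/eqP; apply: contrapT => /negP xy.
  have [f fe /eqP fxy] := @eigenmap_separates R G L Y Yeq Ymin x x y xy; apply: fxy.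
  have [k fk] : exists k, has_degree (f \o p) k.
    by apply: degree_exists => z; apply: continuous_comp; [exact: cp|exact: fe.1].
  have [|c kE] := span k; first by exists f.
  have := @degree0_const (fun x => f x - \sum_i e i x *~ c i) _ _ x y.
  rewrite (_ : \sum_i e i x *~ c i = \sum_i e i y *~ c i).
    move=> H; apply/(addIr _)/H.
      by apply: eigenmapD => //; exact: eigenmapN (comb_eigen c).
    by rewrite -(subrr k) {2}kE; apply: has_degreeD fk (has_degreeN (comb_degree c)).
  apply: eq_bigr => i _; congr (_ *~ _).
  by have := congr1 (fun z : torus R m => z ord0 i) Fxy; rewrite !mxE.
have F_surj z : exists x, F x = z.
  have [|x xE] := @independent_eigenmaps_surj R G L Y Yeq Ymin (p 0) m e ee _ z.
    move=> c cE; apply: free; apply: (@degree_cst R n (\sum_i e i (p 0) *~ c i)).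
    rewrite (_ : (fun _ => _) = (fun x => \sum_i e i x *~ c i) \o p); first exact: comb_degree.
    by apply/funext => x; rewrite /= cE.
  by exists x; apply/rowP => i; rewrite mxE xE.
have F_rot g : exists a, forall x, F (Y g x) = a + F x.
  have /choice[a aE] := fun i => (ee i).2 g.
  by exists (\row_i a i) => x; apply/rowP => i; rewrite !mxE aE.
have [Z [Zmin Zrot Ziso]] := torus_model Ymin cF F_inj F_surj F_rot.
by exists m, Z; split.
Qed.
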